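(* Let $\mathbf{w}$ be a weight in $\mathbb{R}^n$, let $\boldsymbol\theta\in\mathbb{R}^n$, and let $\mathcal{M}$ be a nondegenerate curve in $\mathbb{R}^n$. Then almost every point on $\mathcal{M}$ is not in $\mathbf{Bad}_{\boldsymbol\theta}(\mathbf{w})$.
   Context: A weight in $\mathbb{R}^n$ is a vector $\mathbf{w}=(w_1,\dots,w_n)$ with $w_i\ge 0$ and $\sum_i w_i=1$. $|x|_{\mathbb{Z}}$ is the distance from $x\in\mathbb{R}$ to the nearest integer. For $\boldsymbol\theta=(\theta_i)\in\mathbb{R}^n$, $$\mathbf{Bad}_{\boldsymbol\theta}(\mathbf{w}):=\Big\{\mathbf{x}\in\mathbb{R}^n:\ \liminf_{q\in\mathbb{Z}\setminus\{0\},\,|q|\to\infty}\ \max_{1\le i\le n}|qx_i-\theta_i|_{\mathbb{Z}}^{1/w_i}\,|q|>0\Big\},$$ with the convention $|x|_{\mathbb{Z}}^{1/w_i}:=0$ if $w_i=0$. Let $U\subset\mathbb{R}^d$ be open. A map $\mathbf{f}:U\to\mathbb{R}^n$ is $l$-nondegenerate at $\mathbf{x}\in U$ if $\mathbf{f}$ is $C^l$ on a neighbourhood of $\mathbf{x}$ in $U$ and there are $n$ linearly independent vectors among the partial derivatives of $\mathbf{f}$ at $\mathbf{x}$ of orders between $1$ and $l$. $\mathbf{f}$ is nondegenerate if there is $l$ such that $\mathbf{f}$ is $l$-nondegenerate at Lebesgue almost every $\mathbf{x}\in U$. A nondegenerate curve $\mathcal{M}$ is one parametrized by a nondegenerate map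 $\mathbf{f}:U\to\mathbb{R}^n$ with $U\subset\mathbb{R}$ an open interval ($d=1$); ''almost every point on $\mathcal{M}$'' means $\mathbf{f}(x)$ for Lebesgue almost every $x\in U$. *)

(* Defs.v *)
From HB Require Import structures.
From mathcomp Require Import all_boot all_order all_algebra.
From mathcomp Require Import all_classical all_reals all_analysis.

Set Implicit Arguments.
Unset Strict Implicit.
Unset Printing Implicit Defensive.

Import Order.TTheory GRing.Theory Num.Theory.
Import numFieldNormedType.Exports.

Local Open Scope ring_scope.
Local Open Scope classical_set_scope.

Definition is_weight (R : realType) (n : nat) (w : 'rV[R]_n) : Prop :=
  (forall i, 0 <= w ord0 i) /\ \sum_i w ord0 i = 1.

Definition dist_int (R : realType) (x : R) : R :=
  inf [set `|x - m%:~R| | m in [set: int]].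

(* The separate case is needed because the library has 0^-1 = 0, hence
   x `^ (0^-1) = 1. *)
Definition dist_int_pow (R : realType) (x v : R) : R :=
  if v == 0 then 0 else dist_int x `^ v^-1.

(* The filter "q in Z \ {0}, |q| -> oo". *)
Definition int_infty : set_system int :=
  filter_from [set: nat] (fun N => [set q : int | q != 0 /\ (N <= `|q|)%N]).

(* All the terms are nonnegative, so starting the maximum at 0 does not change
   its value when n > 0 (and there is no weight when n = 0). *)
Definition bad_term (R : realType) (n : nat) (theta w x : 'rV[R]_n) (q : int)
    : R :=
  (\big[Num.max/0]_(i < n)
     dist_int_pow (q%:~R * x ord0 i - theta ord0 i) (w ord0 i)) * `|q%:~R|.

(* limf_einf asks its domain to be a filteredType, which int is not; the
   neighborhoods of principal_filter_type play no role in the value. *)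
Definition Bad (R : realType) (n : nat) (theta w : 'rV[R]_n) : set 'rV[R]_n :=
  [set x | (0 < limf_einf
      (fun q : principal_filter_type int => (bad_term theta w x q)%:E)
      int_infty)%E].

Definition Cl_near (R : realType) (n l : nat) (f : R -> 'rV[R]_n) (x : R)
    : Prop :=
  \forall y \near x,
    (forall k, (k < l)%N -> derivable (f^`(k)) y 1) /\
    {for y, continuous (f^`(l))}.

(* For maps of one real variable the partial derivatives of orders between 1
   and l are the f^`(k) with 1 <= k <= l.  Freeness forces the chosen orders K i
   to be distinct. *)
Definition nondegenerate_at (R : realType) (n l : nat) (f : R -> 'rV[R]_n)
    (x : R) : Prop :=
  Cl_near l f x /\
  exists K : 'I_n -> nat,
    (forall i, (1 <= K i <= l)%N) /\
    free [seq (f^`(K i) x : 'rV[R]_n) | i <- enum 'I_n].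

(* f is a total function standing for a map on U.  For open U nothing below
   depends on its values outside U, since the conditions at a point of U only
   involve f near that point. *)
Definition nondegenerate_map (R : realType) (n : nat) (U : set R)
    (f : R -> 'rV[R]_n) : Prop :=
  exists l : nat,
    {ae @lebesgue_measure R, forall x, U x -> nondegenerate_at l f x}.

Definition nondegenerate_curve (R : realType) (n : nat) (U : set R)
    (f : R -> 'rV[R]_n) : Prop :=
  [/\ open U, is_interval U & nondegenerate_map U f].

(* Main.v *)
(** Order the coordinates so that w_0 is the largest weight.  Fix c and N, and
let E be the set of parameters x at which no q >= N and p satisfy
|q f_i(x) - theta_i - p_i| < (c/q)^(w_i) for all i.  By Lebesgue's density theorem
it is enough to find, around almost every density point of E, arbitrarily short
intervals a fixed proportion of which misses E.

Suppose f_0'(x0) <> 0, and put tau_i = f_i'(x0) / f_0'(x0) if w_i = w_0 and i <> 0,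
tau_i = 0 otherwise.  Suppose that at x near x0 some p and q of order H make
A_0 = q f_0 - theta_0 - p_0 bounded by a multiple of H^(-w_0), and each
A_i - tau_i A_0 by a small multiple of H^(-w_i).  Moving x by O(H^(-1-w_0)) to a
zero of A_0 hardly changes A_i - tau_i A_0, so that all A_i become small on an
interval of length comparable to H^(-1-w_0).

By transference such p and q exist as soon as the dual lattice, deformed by the
diagonal flow, has no nonzero vector shorter than eps.  This holds for at least
half of the points of any fixed interval once H is large, with eps independent
of the interval and of the multiples above: this is quantitative nondivergence
(Kleinbock-Margulis), proved by induction on flags of primitive sublattices,
whose covolumes are maxima of absolute values of functions in the span of
1, f_0, ..., f_n.  That eps does not depend on the multiples is what allows them
to be chosen small. *)

Require Import Defs.
From mathcomp Require Import all_boot all_order all_algebra.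
From mathcomp Require Import all_classical all_reals all_analysis.
From mathcomp Require Import measurable_realfun.
From mathcomp Require Import zify ring lra.

Set Implicit Arguments.
Unset Strict Implicit.
Unset Printing Implicit Defensive.

Import Order.TTheory GRing.Theory Num.Theory.
Import numFieldNormedType.Exports.

Local Open Scope ring_scope.
Local Open Scope classical_set_scope.

(** * Small sets and derivatives at separated points *)

(** A displacement of order H^(-1-w_0) changes A_i by order H^(-w_0). This is negligible against
    H^(-w_i) when w_i < w_0, but of the same order when w_i = w_0; subtracting tau_i A_0 cancels the
    derivative at x0, so that the variation is as small as desired on a short interval around x0.
    The scales T_i have product H, so gaining a factor D in each A_i - tau_i A_0 costs a factor D^n
    in A_0, hence a displacement D^n times longer and a shorter interval around x0. No circle
    arises: D depends only on n, c and eps, and eps is known before the interval.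

    The good half of the interval changes with H, and x0 itself may never be good. As E fills more
    than three quarters of the interval, some other density point x1 of E is good for infinitely
    many H. The holes of E near x1 occupy a fixed proportion of balls shrinking to x1, against
    density at x1. The vector tau remains that of x0 throughout, since nondivergence is applied to
    one fixed deformation on the whole interval. *)

Section Small.
Variable R : realType.
Implicit Types (E : set R) (t : R).
Local Notation mu := (@lebesgue_measure R).

(** A bound for the outer measure: the sets met in the nondivergence argument need not be shown
    measurable. *)
Definition small E t :=
  exists A : set R, [/\ measurable A, E `<=` A & (mu A <= t%:E)%E].

Lemma small_sub E E' t t' : E `<=` E' -> t' <= t -> small E' t' -> small E t.
Proof.
move=> EE tt [A [mA EA At]]; exists A; split => //.
  exact: subset_trans EE EA.
by apply: le_trans At _; rewrite lee_fin.
Qed.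

Lemma small0 t : 0 <= t -> small set0 t.
Proof. by move=> t0; exists set0; split => //; rewrite measure0 lee_fin. Qed.

Lemma smallU E E' t t' : small E t -> small E' t' -> small (E `|` E') (t + t').
Proof.
move=> [A [mA EA At]] [B [mB EB Bt]]; exists (A `|` B); split.
- exact: measurableU.
- exact: setUSS.
- apply: (@le_trans _ _ (mu A + mu B)%E); first exact: measureU2.
  by rewrite EFinD leeD.
Qed.

Lemma small_itv (u v : R) : u <= v -> small `[u, v] (v - u).
Proof.
move=> uv; exists `[u, v]%classic; split => //.
rewrite lebesgue_measure_itv/= lte_fin; case: ltP => // vu.
by rewrite lee_fin subr_ge0.
Qed.

(** Continuity from below for outer measure. The covers [A i] need not be nested, but [B k], the
    intersection of those of index at least [k], increases with [k] and still contains [E k]. *)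
Lemma small_liminf (E : nat -> set R) t :
  (forall i, E i `<=` E i.+1) -> (forall i, small (E i) t) ->
  small (\bigcup_i E i) t.
Proof.
move=> ndE /choice [A AP].
have mono i j : (i <= j)%N -> E i `<=` E j.
  move=> /subnK <-; elim: (j - i)%N => [//|k IH].
  by rewrite addSn; apply: subset_trans IH _; exact: ndE.
pose B k := \bigcap_(j in [set j | (k <= j)%N]) A j.
have mB k : measurable (B k).
  apply: bigcap_measurable; first by exists k => /=.
  by move=> j _; case: (AP j).
have mUB : measurable (\bigcup_k B k) by exact: bigcup_measurable.
exists (\bigcup_k B k); split => //.
- move=> x [i _ Eix]; exists i => // j /= ij.
  by case: (AP j) => _ + _; apply; exact: mono Eix.
- have ndB : nondecreasing_seq B.
    move=> i j ij; apply/subsetPset => x Bx k /= jk.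
    by apply: Bx => /=; apply: leq_trans jk.
  have cB := @nondecreasing_cvg_mu _ _ _ mu _ mB mUB ndB.
  rewrite -(cvg_lim _ cB)//; apply: lime_le; first by apply/cvg_ex; eexists; exact: cB.
  apply: nearW => k /=; case: (AP k) => mA _ At.
  apply: le_trans At; apply: (@le_measure _ _ _ mu); rewrite ?inE.
  - exact: mB.
  - exact: mA.
  - by move=> x Bx; apply: (Bx k (leqnn k)).
Qed.

(* Greedy choice from the left end of Z, at cost 2 g for each point. *)
Lemma separated_or_small (Z : set R) (u g : R) (N : nat) : 0 <= g ->
  (forall z, Z z -> u <= z) ->
  small Z (N%:R * (2 * g)) \/
  exists z : nat -> R, (forall i, (i <= N)%N -> Z (z i)) /\
    (forall i j, (i < j <= N)%N -> z i + g <= z j).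
Proof.
move=> g0; elim: N Z u => [|N IH] Z u Zu.
  have [->|/set0P[z Zz]] := eqVneq Z set0; first by left; apply: small0; rewrite mul0r.
  by right; exists (fun=> z); split=> // i j; lia.
have [->|/set0P Z0] := eqVneq Z set0.
  by left; apply: small0; rewrite mulr_ge0// mulr_ge0.
have [g00|gp] := eqVneq g 0.
  case: Z0 => z Zz; right; exists (fun=> z); split=> // i j _.
  by rewrite g00 addr0.
have {}gp : 0 < g by rewrite lt_def gp.
have hi : has_inf Z by split => //; exists u => z /Zu.
pose s := inf Z.
have sZ z : Z z -> s <= z by move=> Zz; apply: ge_inf => //; case: hi.
pose Z' := Z `&` [set z | s + 2 * g < z].
have [sm|[z [zZ zs]]] := IH Z' (s + 2 * g) (fun z Zz => ltW Zz.2).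
  left; apply: (@small_sub _ (`[s, s + 2 * g] `|` Z') _
      ((s + 2 * g - s) + N%:R * (2 * g))).
  - move=> z Zz /=; rewrite in_itv/= sZ//=.
    have [h|h] := leP z (s + 2 * g); first by left.
    by right; split.
  - by rewrite -natr1; lra.
  - by apply: smallU => //; apply: small_itv; lra.
right.
have [z1 Zz1 z1s] := inf_adherent gp hi.
exists (fun i => if i is i'.+1 then z i' else z1); split.
  by move=> [|i] // iN; case: (zZ i iN).
move=> [|i] [|j] /andP[ij jN] //=.
- have [_ /=] := zZ j jN; rewrite -/s in z1s; lra.
- by apply: zs; rewrite -ltnS ij.
Qed.

End Small.

Section DerivativeChain.
Variable R : realType.
Implicit Types (u v x : R) (G : nat -> R -> R).

Lemma mvt_norm (f df : R -> R) u v :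
  u < v -> (forall x, u <= x <= v -> is_derive x 1 f (df x)) ->
  exists2 c, u <= c <= v & f v - f u = df c * (v - u).
Proof.
move=> uv fd.
have [c cuv ->] : exists2 c, c \in `]u, v[%R & f v - f u = df c * (v - u).
  apply: MVT => // [x xuv|].
    by apply: fd; rewrite !ltW ?(itvP xuv).
  apply: derivable_within_continuous => x; rewrite in_itv/= => xuv.
  by have [] := fd x xuv.
by exists c => //; rewrite !ltW ?(itvP cuv).
Qed.

Lemma lipschitz_itv (f df : R -> R) u v K :
  (forall x, u <= x <= v -> is_derive x 1 f (df x)) ->
  (forall x, u <= x <= v -> `|df x| <= K) ->
  forall x y, u <= x <= v -> u <= y <= v -> `|f y - f x| <= K * `|y - x|.
Proof.
move=> fd fK x y; wlog xy : x y / x <= y => [H xuv yuv|xuv yuv].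
  have [/H|/ltW/H] := leP x y; first exact.
  by rewrite distrC [X in _ <= _ * X]distrC; apply.
move: xy; rewrite le_eqVlt => /predU1P[->|xy].
  by rewrite !subrr normr0 mulr0.
have [c cxy ->] := @mvt_norm f df x y xy (fun z zxy => fd z ltac:(lra)).
by rewrite normrM ler_wpM2r// fK//; lra.
Qed.

(* Between two points at distance at least g where f is at most b in absolute
   value, some value of the derivative is at most 2 b / g; pairing consecutive
   points keeps these new points separated. *)
Lemma separated_derivative_points k (f df : R -> R) u v g b (z : nat -> R) :
  0 < g -> (forall x, u <= x <= v -> is_derive x 1 f (df x)) ->
  (forall i, (i < 2 ^ k.+1)%N -> u <= z i <= v /\ `|f (z i)| <= b) ->
  (forall i j, (i < j < 2 ^ k.+1)%N -> z i + g <= z j) ->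
  exists y : nat -> R,
    (forall i, (i < 2 ^ k)%N -> u <= y i <= v /\ `|df (y i)| <= 2 / g * b) /\
    (forall i j, (i < j < 2 ^ k)%N -> y i + g <= y j).
Proof.
move=> g0 fd; rewrite expnS => zuv zs.
have H i : exists x, (i < 2 ^ k)%N ->
    z i.*2 <= x <= z i.*2.+1 /\ `|df x| <= 2 / g * b.
  case: (ltnP i (2 ^ k)) => ik; last by exists 0.
  have i1 : (i.*2 < i.*2.+1 < 2 * 2 ^ k)%N by lia.
  have [z1 G1] := zuv i.*2 ltac:(lia).
  have [z2 G2] := zuv i.*2.+1 ltac:(lia).
  have zz := zs _ _ i1.
  have [c cz e] := @mvt_norm f df (z i.*2) (z i.*2.+1) ltac:(lra)
    (fun x xz => fd x ltac:(lra)).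
  exists c => _; split=> //.
  have : `|df c| * g <= 2 * b.
    apply: (@le_trans _ _ (`|f (z i.*2.+1) - f (z i.*2)|)).
      rewrite e normrM; apply: ler_wpM2l => //.
      by rewrite ger0_norm; lra.
    apply: (le_trans (ler_normB _ _)); lra.
  by rewrite -ler_pdivlMr// mulrAC.
have {H} [y Hy] := choice H.
exists y; split => [i ik|i j /andP[ij jk]].
  have [yi Gi] := Hy i ik; split=> //.
  have [h1 _] := zuv i.*2 ltac:(lia).
  have [h2 _] := zuv i.*2.+1 ltac:(lia).
  lra.
have [yi _] := Hy i ltac:(lia); have [yj _] := Hy j jk.
have := zs i.*2.+1 j.*2 ltac:(lia); lra.
Qed.

(** Each differentiation halves the number of points and multiplies the bound by 2/g, so 2^k points
    leave one for the k-th derivative. *)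
Lemma separated_small_derivative k G u v g b (z : nat -> R) :
  0 < g -> 0 <= b ->
  (forall j x, (j < k)%N -> u <= x <= v -> is_derive x 1 (G j) (G j.+1 x)) ->
  (forall i, (i < 2 ^ k)%N -> u <= z i <= v /\ `|G 0 (z i)| <= b) ->
  (forall i j, (i < j < 2 ^ k)%N -> z i + g <= z j) ->
  exists2 x, u <= x <= v & `|G k x| <= (2 / g) ^+ k * b.
Proof.
move=> g0; elim: k G b z => [|k IH] G b z b0 dG zuv zs.
  by have [] := zuv 0%N isT; exists (z 0%N) => //; rewrite expr0 mul1r.
have [y [yuv ys]] := separated_derivative_points g0 (fun x => dG 0%N x isT) zuv zs.
have [|j x' jk|x xuv Gx] := IH (fun j => G j.+1) (2 / g * b) y _ _ yuv ys.
- by rewrite mulr_ge0// divr_ge0// ltW.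
- exact: dG.
by exists x => //; rewrite exprSr -mulrA.
Qed.

(** A substitute for Lagrange interpolation: the derivative is small at 2^(k-1) intermediate points,
    hence bounded everywhere by induction, and the mean value inequality starting from [z 0] bounds
    the function. *)
Lemma separated_small_sup k G u v g b B (z : nat -> R) :
  0 < g -> 0 <= b ->
  (forall j x, (j < k)%N -> u <= x <= v -> is_derive x 1 (G j) (G j.+1 x)) ->
  (forall i, (i < 2 ^ k)%N -> u <= z i <= v /\ `|G 0 (z i)| <= b) ->
  (forall i j, (i < j < 2 ^ k)%N -> z i + g <= z j) ->
  (forall x, u <= x <= v -> `|G k x| <= B) ->
  forall x, u <= x <= v ->
  `|G 0 x| <= (\sum_(j < k) ((v - u) * (2 / g)) ^+ j) * b + (v - u) ^+ k * B.
Proof.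
move=> g0; elim: k G b z => [|k IH] G b z b0 dG zuv zs GB x xuv.
  by rewrite big_ord0 mul0r add0r expr0 mul1r GB.
have [y [yuv ys]] := separated_derivative_points g0 (fun x => dG 0%N x isT) zuv zs.
have G1 : forall x, u <= x <= v -> `|G 1%N x| <=
    (\sum_(j < k) ((v - u) * (2 / g)) ^+ j) * (2 / g * b) + (v - u) ^+ k * B.
  apply: (IH (fun j => G j.+1) _ y) => //.
  - by rewrite mulr_ge0// divr_ge0// ltW.
  - by move=> j x' jk; apply: dG.
have [z0uv z0b] := zuv 0%N ltac:(rewrite expn_gt0; lia).
have uv : 0 <= v - u by lra.
have := lipschitz_itv (fun x' => dG 0%N x' isT) G1 z0uv xuv.
set C := (X in X * `|_|) => CL.
have C0 : 0 <= C.
  by apply: le_trans (G1 (z 0%N) z0uv).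
have : `|x - z 0%N| <= v - u by rewrite ler_norml; apply/andP; split; lra.
move=> /(ler_wpM2l C0) h.
have : `|G 0 x| <= b + C * (v - u).
  rewrite -(subrK (G 0 (z 0%N)) (G 0 x)); apply: (le_trans (ler_normD _ _)); lra.
move=> /le_trans; apply.
rewrite big_ord_recl expr0 /C le_eqVlt; apply/orP; left; apply/eqP.
have -> : \sum_(i < k) ((v - u) * (2 / g)) ^+ lift ord0 i =
   (v - u) * (2 / g) * \sum_(j < k) ((v - u) * (2 / g)) ^+ j.
  by rewrite mulr_sumr; apply: eq_bigr => i _; rewrite /= /bump /= add1n exprS.
rewrite [(v - u) ^+ k.+1]exprS; move: (\sum_(j < k) _) => S; ring.
Qed.

End DerivativeChain.

(** * Affine combinations of the coordinates of a nondegenerate curve *)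

Section Chart.
Variable R : realType.

(* F i j is the j-th derivative of the i-th coordinate on ]a, b[. *)
Definition chart n l (F : 'I_n -> nat -> R -> R) (a b K kap : R) : Prop :=
  [/\ 0 < kap, 0 <= K,
   forall i j x, a < x < b -> (j < l)%N -> is_derive x 1 (F i j) (F i j.+1 x),
   forall i j x, a < x < b -> (j <= l)%N -> `|F i j x| <= K &
   forall c : 'I_n -> R, exists k, (1 <= k <= l)%N /\
     forall x, a < x < b -> forall i, kap * `|c i| <= `|\sum_i c i * F i k x| ].

Definition affine_comb n (F : 'I_n -> nat -> R -> R) (c0 : R) (c : 'I_n -> R) x :=
  c0 + \sum_i c i * F i 0 x.

Let chain n (F : 'I_n -> nat -> R -> R) c0 c j :=
  if j is 0 then affine_comb F c0 c else fun x => \sum_i c i * F i j x.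

Lemma is_derive_affine_comb n l (F : 'I_n -> nat -> R -> R) a b K kap c0 c j x :
  chart l F a b K kap -> a < x < b -> (j < l)%N ->
  is_derive x 1 (chain F c0 c j) (chain F c0 c j.+1 x).
Proof.
move=> [_ _ dF _ _] xab jl.
have d i : is_derive x 1 (fun y => c i * F i j y) (c i * F i j.+1 x).
  have := dF i j x xab jl => dFi.
  exact: is_deriveZ.
have ds : is_derive x 1 (fun y => \sum_i c i * F i j y) (\sum_i c i * F i j.+1 x).
  rewrite (_ : (fun y => _) = \sum_i (fun y => c i * F i j y)).
    exact: is_derive_sum.
  by apply/funext => y; rewrite fct_sumE.
case: j jl d ds => [|j] jl d ds //=.
rewrite (_ : affine_comb F c0 c = cst c0 + (fun y => \sum_i c i * F i 0 y)) //.
by rewrite -[X in is_derive _ _ _ X]add0r; apply: is_deriveD.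
Qed.

(** A form of the (C, alpha)-good property, with [delta] independent of the coefficients and of the
    interval. A larger set would contain more than 2^k points at mutual distance proportional to v -
    u. The k-th derivative would then be small at one point, hence all [c i] small by the last
    clause of [chart], hence the k-th derivative small throughout, and finally the function too
    small at [z0]. *)
Lemma affine_comb_good n l (F : 'I_n -> nat -> R -> R) a b K kap :
  chart l F a b K kap -> forall eta, 0 < eta ->
  exists2 delta, 0 < delta <= 1 & forall c0 c u v z0, a < u -> u < v -> v < b ->
    u <= z0 <= v -> 0 < `|affine_comb F c0 c z0| ->
    small [set z | u <= z <= v /\
      `|affine_comb F c0 c z| < delta * `|affine_comb F c0 c z0| ] (eta * (v - u)).
Proof.
move=> ch eta eta0; have [kap0 K0 dF FK Fk] := ch.
pose gam := eta / (2 * 2 ^+ l); pose A := 1 + 2 / gam.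
have gam0 : 0 < gam by rewrite divr_gt0// mulr_gt0// exprn_gt0.
have tg : 0 <= 2 / gam by rewrite divr_ge0// ltW.
have A1 : 1 <= A by rewrite lerDl.
have tA : 2 / gam <= A by rewrite lerDr.
have Al1 : 1 <= A ^+ l by rewrite exprn_ege1.
(* [X] collects the geometric sum, at most l A^l, and the bound n K / kap for the k-th derivative;
   [delta] = 1 / (2 X A^l) makes the value at [z0] at most half of itself. *)
pose X := l%:R + n%:R * (K / kap) + 1.
have X1 : 1 <= X by rewrite lerDr addr_ge0// mulr_ge0// divr_ge0// ltW.
have XA1 : 1 <= X * A ^+ l by rewrite mulr_ege1.
exists (2 * (X * A ^+ l))^-1.
  by rewrite invr_gt0 invf_le1 ?mulr_gt0//; lra.
set delta := _^-1 => c0 c u v z0 au uv vb z0uv g0.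
set g := affine_comb F c0 c; set Z := [set z | _].
have [k [/andP[k1 kl] ck]] := Fk c.
have L0 : 0 < v - u by rewrite subr_gt0.
have gL : 0 < gam * (v - u) by rewrite mulr_gt0.
have [sm|[z [zZ zs]]] := @separated_or_small R Z u (gam * (v - u)) (2 ^ k)
    (ltW gL) (fun z Zz => proj1 (andP Zz.1)).
  apply: small_sub sm => //.
  have -> : eta = gam * (2 * 2 ^+ l).
    by rewrite /gam divfK// gt_eqF// mulr_gt0// exprn_gt0.
  have : (2 : R) ^+ k <= 2 ^+ l by rewrite ler_eXn2l// ltr1n.
  rewrite natrX; move: (2 ^+ k) (2 ^+ l) => p q pq; nra.
exfalso.
set M := `|g z0| in g0; set bb := delta * M.
have delta0 : 0 < delta by rewrite invr_gt0; lra.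
have bb0 : 0 <= bb by rewrite mulr_ge0// ltW.
have dch j x : (j < k)%N -> u <= x <= v ->
    is_derive x 1 (chain F c0 c j) (chain F c0 c j.+1 x).
  move=> jk xuv; apply: (is_derive_affine_comb _ _ ch); first lra.
  exact: leq_trans kl.
have zuv i : (i < 2 ^ k)%N -> u <= z i <= v /\ `|chain F c0 c 0 (z i)| <= bb.
  by move=> ik; have [h1 h2] := zZ i (ltnW ik); split => //; apply: ltW.
have zsep i j : (i < j < 2 ^ k)%N -> z i + gam * (v - u) <= z j.
  by move=> /andP[ij jk]; apply: zs; rewrite ij ltnW.
have [xi xiuv Gxi] := separated_small_derivative gL bb0 dch zuv zsep.
have cGk : chain F c0 c k = fun x => \sum_i c i * F i k x by case: (k) k1.
set Y := (2 / (gam * (v - u))) ^+ k * bb in Gxi.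
have ci i : `|c i| <= Y / kap.
  rewrite ler_pdivlMr// mulrC; apply: (le_trans (ck xi _ i)); first lra.
  by move: Gxi; rewrite cGk.
have GB x : u <= x <= v -> `|chain F c0 c k x| <= n%:R * (K / kap) * Y.
  move=> xuv; rewrite cGk; apply: (le_trans (ler_norm_sum _ _ _)).
  apply: (@le_trans _ _ (\sum_(i < n) (K / kap) * Y)); last first.
    by rewrite sumr_const card_ord -[X in X <= _]mulr_natl mulrA.
  apply: ler_sum => i _; rewrite normrM.
  have -> : K / kap * Y = Y / kap * K by ring.
  by apply: ler_pM => //; apply: FK => //; lra.
have := separated_small_sup gL bb0 dch zuv zsep GB z0uv.
rewrite /= -/g -/M.
(* Here the length of the interval cancels, which makes [delta] uniform. *)
have -> : (v - u) * (2 / (gam * (v - u))) = 2 / gam.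
  by field; rewrite ?gt_eqF//=.
have -> : (v - u) ^+ k * (n%:R * (K / kap) * Y) = n%:R * (K / kap) * (2 / gam) ^+ k * bb.
  rewrite /Y.
  have -> : (2 / gam) ^+ k = (v - u) ^+ k * (2 / (gam * (v - u))) ^+ k.
    by rewrite -exprMn; congr (_ ^+ _); field; rewrite ?gt_eqF//=.
  by move: (_ ^+ k) ((v - u) ^+ k) => p q; ring.
have gA j : (j <= l)%N -> (2 / gam) ^+ j <= A ^+ l.
  move=> jl; apply: (@le_trans _ _ (A ^+ j)); last by rewrite ler_weXn2l.
  by apply: lerXn2r; rewrite ?nnegrE//; lra.
have S1 : \sum_(j < k) (2 / gam) ^+ j <= l%:R * A ^+ l.
  apply: (@le_trans _ _ (\sum_(j < k) A ^+ l)).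
    by apply: ler_sum => j _; apply: gA; apply: leq_trans kl; apply: ltnW.
  rewrite sumr_const card_ord -[X in X <= _]mulr_natl ler_wpM2r ?ler_nat//; lra.
have S2 : n%:R * (K / kap) * (2 / gam) ^+ k <= n%:R * (K / kap) * A ^+ l.
  by apply: ler_wpM2l; [rewrite mulr_ge0// divr_ge0// ltW|exact: gA].
move=> MM.
have : M <= X * A ^+ l * bb.
  apply: (le_trans MM); rewrite -mulrDl; apply: ler_wpM2r => //.
  rewrite /X; nra.
have -> : X * A ^+ l * bb = M / 2.
  rewrite /bb /delta; field; rewrite ?gt_eqF//=; lra.
lra.
Qed.

(** Quantitative linear independence of 1 and the coordinates: smallness at 2^k equally spaced
    points bounds all [c i] through the k-th derivative, and then [c0] through the value at [u].
    Unlike [delta] above, [rho] depends on the interval. *)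
Lemma affine_comb_lower n l (F : 'I_n -> nat -> R -> R) a b K kap u v :
  chart l F a b K kap -> a < u -> u < v -> v < b ->
  exists2 rho, 0 < rho & forall c0 c, exists2 z, u <= z <= v &
   rho * `|c0| <= `|affine_comb F c0 c z| /\
   forall i, rho * `|c i| <= `|affine_comb F c0 c z|.
Proof.
move=> ch au uv vb; have [kap0 K0 dF FK Fk] := ch.
pose g := (v - u) / 2 ^+ l; pose A := 1 + 2 / g.
have g0 : 0 < g by rewrite divr_gt0 ?exprn_gt0// subr_gt0.
have tg : 0 <= 2 / g by rewrite divr_ge0// ltW.
have A1 : 1 <= A by rewrite lerDl.
have tA : 2 / g <= A by rewrite lerDr.
pose X := 1 + (K + 1) * n%:R * (A ^+ l / kap).
have AK : 0 <= A ^+ l / kap by rewrite divr_ge0 ?exprn_ge0 ?ltW//; lra.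
have X1 : 1 <= X by rewrite lerDl; apply: mulr_ge0 => //; apply: mulr_ge0 => //; lra.
exists (2 * X)^-1; first by rewrite invr_gt0; lra.
move=> c0 c; pose S := `|c0| + \sum_i `|c i|.
have S0 : 0 <= S by rewrite addr_ge0// sumr_ge0.
suff [z zuv gz] : exists2 z, u <= z <= v & (2 * X)^-1 * S <= `|affine_comb F c0 c z|.
  exists z => //; have X0 : 0 <= (2 * X)^-1 by rewrite invr_ge0; lra.
  split => [|i]; apply: le_trans gz; apply: ler_wpM2l => //.
    by rewrite lerDl sumr_ge0.
  by rewrite /S (bigD1 i)//= addrCA lerDl addr_ge0// sumr_ge0.
apply: contrapT => H.
have S0' : 0 < S.
  rewrite lt_def S0 andbT; apply/negP => /eqP S00; apply: H; exists u; first lra.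
  by rewrite S00 mulr0.
pose bb := (2 * X)^-1 * S.
have bb0 : 0 <= bb by rewrite mulr_ge0// invr_ge0; lra.
have gb z : u <= z <= v -> `|affine_comb F c0 c z| <= bb.
  move=> zuv; rewrite leNgt; apply/negP => /ltW zb; apply: H; by exists z.
have [k [/andP[k1 kl] ck]] := Fk c.
have dch j x : (j < k)%N -> u <= x <= v ->
    is_derive x 1 (chain F c0 c j) (chain F c0 c j.+1 x).
  move=> jk xuv; apply: (is_derive_affine_comb _ _ ch); first lra.
  exact: leq_trans kl.
pose z i := u + i%:R * g.
have zuv i : (i < 2 ^ k)%N -> u <= z i <= v /\ `|chain F c0 c 0 (z i)| <= bb.
  move=> ik.
  have zi : u <= z i <= v.
    have i0 : 0 <= i%:R * g by rewrite mulr_ge0// ltW.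
    have i1 : i%:R * g <= v - u.
      rewrite /g mulrCA ger_pMr ?subr_gt0// ler_pdivrMr ?exprn_gt0// mul1r.
      by rewrite -natrX ler_nat (leq_trans (ltnW ik))// leq_pexp2l.
    rewrite /z; lra.
  by split => //; apply: gb.
have zsep i j : (i < j < 2 ^ k)%N -> z i + g <= z j.
  move=> /andP[ij jk]; have : (i.+1)%:R * g <= j%:R * g by apply: ler_wpM2r; [exact: ltW|rewrite ler_nat].
  by rewrite /z -natr1; lra.
have [xi xiuv Gxi] := separated_small_derivative g0 bb0 dch zuv zsep.
have cGk : chain F c0 c k = fun x => \sum_i c i * F i k x by case: (k) k1.
have Ak : (2 / g) ^+ k <= A ^+ l.
  apply: (@le_trans _ _ (A ^+ k)); last by rewrite ler_weXn2l.
  by apply: lerXn2r; rewrite ?nnegrE//; lra.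
have ci i : `|c i| <= A ^+ l / kap * bb.
  rewrite mulrAC ler_pdivlMr// mulrC; apply: (le_trans (ck xi _ i)); first lra.
  move: Gxi; rewrite cGk => /le_trans; apply; exact: ler_wpM2r.
have sc : \sum_i `|c i| <= n%:R * (A ^+ l / kap * bb).
  apply: (@le_trans _ _ (\sum_(i < n) (A ^+ l / kap * bb))); first exact: ler_sum.
  by rewrite sumr_const card_ord -[X in X <= _]mulr_natl.
have c0b : `|c0| <= bb + K * (n%:R * (A ^+ l / kap * bb)).
  have -> : c0 = affine_comb F c0 c u - \sum_i c i * F i 0 u.
    by rewrite /affine_comb addrK.
  apply: (le_trans (ler_normB _ _)); apply: lerD; first by apply: gb; lra.
  apply: (le_trans (ler_norm_sum _ _ _)).
  apply: (@le_trans _ _ (K * \sum_i `|c i|)); last exact: ler_wpM2l.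
  rewrite mulr_sumr; apply: ler_sum => i _; rewrite normrM mulrC ler_wpM2r//.
  by apply: FK => //; lra.
have : S <= X * bb.
  rewrite /S /X; move: (A ^+ l / kap) AK c0b sc => W W0 c0b sc.
  apply: (le_trans (lerD c0b sc)); nra.
have -> : X * bb = S / 2.
  by rewrite /bb; field; rewrite gt_eqF//=; lra.
lra.
Qed.

Lemma affine_comb_continuous n l (F : 'I_n -> nat -> R -> R) a b K kap c0 c x :
  chart l F a b K kap -> a < x < b -> {for x, continuous (affine_comb F c0 c)}.
Proof.
move=> ch xab; have [_ _ _ _ Fk] := ch; have [k [/andP[k1 kl] _]] := Fk (fun=> 0).
have [d _] := is_derive_affine_comb c0 c ch xab (leq_trans k1 kl).
exact/differentiable_continuous/derivable1_diffP.
Qed.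

End Chart.

(** * Nondivergence for a family indexed by flags *)

Section Nondivergence.
(** In the application a label is a primitive sublattice, [psi s x] its covolume at the parameter
    [x], and [Bd] the set of parameters at which the lattice has a short vector. *)
Variables (R : realType) (L : eqType) (ok : L -> Prop) (rk : L -> nat).
Variables (cmp : L -> L -> Prop) (psi : L -> R -> R) (n : nat).
Variables (a b delta eta : R) (Bd : set R).

Definition flag (S : seq L) : Prop :=
  [/\ uniq (map rk S), {in S, forall s, ok s /\ (1 <= rk s <= n)%N} &
      {in S &, forall s t, cmp s t}].

Definition extends_flag (S : seq L) (s : L) : Prop :=
  [/\ ok s, (1 <= rk s <= n)%N & {in S, forall t, cmp s t /\ rk s <> rk t}].

(** A new label costs [eta] for the points where its function falls below [delta]; the factor 2
    appears because the estimate is made on an interval twice as long as the one where the label was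
    found. *)
Fixpoint loss r : R := if r is r'.+1 then 2 * (eta + loss r') else 0.

Hypothesis eta_ge0 : 0 <= eta.
Hypothesis cmp_refl : forall s, cmp s s.
Hypothesis cmp_sym : forall s t, cmp s t -> cmp t s.
Hypothesis psi_usc : forall s x, a < x < b -> psi s x < 1 ->
  \forall y \near x, psi s y < 1.
Hypothesis psi_good : forall s u v z0, a < u -> u < v -> v < b ->
  u <= z0 <= v -> 1 <= psi s z0 ->
  small [set z | u <= z <= v /\ psi s z < delta] (eta * (v - u)).
(** These are the marked points of Kleinbock and Margulis: no label of value below 1 can be added to
    the flag there. *)
Hypothesis flag_good : forall S z, a < z < b -> flag S ->
  {in S, forall s, delta <= psi s z <= 1} ->
  (forall s, extends_flag S s -> 1 <= psi s z) -> ~ Bd z.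

Lemma loss_ge0 r : 0 <= loss r.
Proof. by elim: r => //= r IH; rewrite mulr_ge0// addr_ge0. Qed.

Lemma flag_cons S s : flag S -> extends_flag S s -> flag (s :: S).
Proof.
move=> [uS okS cS] [oks rks cs]; split.
- rewrite /= uS andbT; apply/mapP => -[t tS]; by have [] := cs t tS.
- by move=> t; rewrite inE => /predU1P[->|/okS].
- move=> t t'; rewrite !inE => /predU1P[->|tS] /predU1P[->|t'S] //.
  + by have [] := cs t' t'S.
  + by apply: cmp_sym; have [] := cs t tS.
  + exact: cS.
Qed.

Lemma flag_size S s : flag S -> extends_flag S s -> (size S < n)%N.
Proof.
move=> fS es; have [/= uS okS _] := flag_cons fS es.
have := @uniq_leq_size _ (rk s :: map rk S) (iota 1 n) uS.
rewrite /= size_map size_iota; apply.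
move=> k /(@mapP _ _ rk (s :: S))[t tS ->].
by have [_] := okS t tS; rewrite mem_iota; lia.
Qed.

Section Step.
Variables (S : seq L) (c : R) (E : set R).
Let low u v := exists2 s, extends_flag S s &
  forall z, u <= z <= v -> psi s z < 1.
Hypothesis c0 : 0 <= c.
Hypothesis E_low : forall z, a < z < b -> E z ->
  exists2 s, extends_flag S s & psi s z < 1.
Hypothesis low_small : forall u v u' v', a < u -> u < v -> v < b -> ~ low u v ->
  u <= u' -> v' <= v -> v - u = 2 * (v' - u') -> low u' v' ->
  small [set z | u' <= z <= v' /\ E z] (c * (v' - u')).

Let Esub J := [set y | E y /\ forall u v, a < u -> v < b -> u <= y <= v ->
  v - u < 2 ^- J -> low u v].

(** Halving stops as soon as a half is low; [low_small] then applies, the parent not being low.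
    After [p] halvings the length is below 2^-J, and an interval that short which is not low
    contains no point of [Esub J]. *)
Lemma bisection J p u v : a < u -> u < v -> v < b -> ~ low u v ->
  v - u < 2 ^+ p * 2 ^- J ->
  small [set z | u <= z <= v /\ Esub J z] (c * (v - u)).
Proof.
elim: p u v => [|p IH] u v au uv vb nlow uvJ.
  rewrite (_ : mkset _ = set0); first by apply: small0; rewrite mulr_ge0// subr_ge0 ltW.
  apply/seteqP; split => // z [zuv [Ez Lz]]; apply: nlow; apply: Lz => //.
  by rewrite expr0 mul1r in uvJ.
pose m := (u + v) / 2.
have half u' v' : u <= u' -> u' < v' -> v' <= v -> v - u = 2 * (v' - u') ->
    small [set z | u' <= z <= v' /\ Esub J z] (c * (v' - u')).
  move=> uu uv' vv e; have [lo|nlo] := pselect (low u' v').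
    apply: small_sub (low_small au uv vb nlow uu vv e lo) => // z [? []] //.
  apply: IH => //; [lra|lra|].
  move: uvJ; rewrite exprS -mulrA; move: (_ * 2 ^- J) => q; lra.
apply: (@small_sub _ _ ([set z | u <= z <= m /\ Esub J z] `|`
    [set z | m <= z <= v /\ Esub J z]) _ (c * (m - u) + c * (v - m))).
- move=> z [zuv Ez]; have [zm|mz] := leP z m; [left|right]; split => //; lra.
- rewrite -mulrDr; apply: ler_wpM2l => //; lra.
- by apply: smallU; apply: half; rewrite /m; lra.
Qed.

(** This replaces a covering theorem: the halves produced by bisection overlap only at endpoints.
    Each point of [E] lies in some [Esub J] because psi < 1 is an open condition, and these sets
    increase with [J]. *)
Lemma stopping_time u v : a < u -> u < v -> v < b -> ~ low u v ->
  small [set z | u <= z <= v /\ E z] (c * (v - u)).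
Proof.
move=> au uv vb nlow.
pose EJ J := [set z | u <= z <= v /\ Esub J z].
apply: (@small_sub _ _ (\bigcup_J EJ J) _ (c * (v - u))) => //.
  move=> z [zuv Ez]; have zab : a < z < b by lra.
  have [s es psz] := E_low zab Ez.
  have /nbhs_ballP[e /= e0 He] := psi_usc zab psz.
  have [J _ HJ] : exists2 J : nat, True & 2 ^- J < e.
    pose J := Num.bound e^-1; exists J => //.
    have J1 : e^-1 < 2 ^+ J.
      have /archi_boundP : 0 <= e^-1 by rewrite invr_ge0 ltW.
      move=> /lt_le_trans; apply; rewrite -natrX ler_nat.
      by rewrite ltnW// ltn_expl.
    by rewrite invf_plt ?posrE ?exprn_gt0.
  exists J => //; split => //; split => // u' v' au' v'b zu'v' u'v'.
  exists s => // y yu'v'; apply: He; rewrite /ball /=.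
  rewrite ltr_norml; apply/andP; split; lra.
apply: small_liminf => [J z [zuv [Ez Lz]]|J].
  split => //; split => // u' v' au' v'b zu'v' u'v'; apply: Lz => //.
  apply: lt_trans u'v' _; rewrite ltf_pV2 ?posrE ?exprn_gt0// exprS.
  by rewrite ltr_pMl ?exprn_gt0// ltr1n.
pose p := Num.bound ((v - u) * 2 ^+ J).
apply: (@bisection J p) => //.
have /archi_boundP : 0 <= (v - u) * 2 ^+ J by rewrite mulr_ge0 ?exprn_ge0// subr_ge0 ltW.
rewrite -/p -ltr_pdivlMr ?exprn_gt0// => /lt_le_trans; apply.
apply: ler_wpM2r; first by rewrite invr_ge0 exprn_ge0.
by rewrite -natrX ler_nat ltnW// ltn_expl.
Qed.

End Step.

(** On a half [u', v'] where bisection stops, some label [s] stays below 1, while on the parent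
    [u, v] it reaches 1; so it is at least [delta] on the parent outside a set of measure eta (v -
    u). Where it lies between [delta] and 1 it joins the flag. *)
Lemma nondivergence r S u v : flag S -> (n <= size S + r)%N ->
  a < u -> u < v -> v < b ->
  (forall s, extends_flag S s -> exists2 z, u <= z <= v & 1 <= psi s z) ->
  small [set z | u <= z <= v /\
    (Bd z /\ {in S, forall s, delta <= psi s z <= 1})] (loss r * (v - u)).
Proof.
elim: r S u v => [|r IH] S u v fS nS au uv vb high.
all: apply: (stopping_time (S := S) (loss_ge0 _)) => //; [
  move=> z zab [Bz Sz]; apply: contrapT => H; apply: (flag_good zab fS) Bz => // s es;
  rewrite leNgt; apply/negP => ps; apply: H; by exists s| |
  by move=> [s es lo]; have [z zuv] := high s es; rewrite leNgt lo].
  (* For r = 0 the flag already has [n] labels, so no label extends it and no interval is low. *)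
  by move=> ? ? ? ? _ _ _ _ _ _ _ [s es]; have := flag_size fS es; lia.
move=> {high} {}u {}v u' v' {}au {}uv {}vb nlow uu vv e [s es lo].
have high s' : extends_flag S s' -> exists2 z, u <= z <= v & 1 <= psi s' z.
  move=> es'; apply: contrapT => H; apply: nlow; exists s' => // z zuv.
  by rewrite ltNge; apply/negP => ?; apply: H; exists z.
have [z0 z0uv pz0] := high s es.
have sm1 := psi_good au uv vb z0uv pz0.
(* The induction hypothesis is used on the parent: there all extensions are known to reach 1, which
   may fail on the half. *)
have sm2 : small [set z | u <= z <= v /\
    (Bd z /\ {in s :: S, forall s, delta <= psi s z <= 1})] (loss r * (v - u)).
  apply: IH => //; [exact: flag_cons|by rewrite /= addSnnS|].
  move=> s' [oks rks cs]; apply: high; split => // t tS; apply: cs.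
  by rewrite inE tS orbT.
apply: small_sub (smallU sm1 sm2).
  move=> z [zuv [Bz Sz]]; have zuv' : u <= z <= v by lra.
  have [pd|pd] := ltP (psi s z) delta; [left|right] => //.
  split => //; split => // t; rewrite inE => /predU1P[->|/Sz//].
  by rewrite pd ltW// lo.
rewrite -mulrDl e /=; lra.
Qed.

End Nondivergence.

(** * Transference *)

Section Covering.
Variable R : realType.
Local Notation "M '%:r'" := (map_mx intr M : 'M[R]_(_, _)) (at level 2, format "M %:r").

Definition dot m (x y : 'rV[R]_m) : R := (x *m y^T) ord0 ord0.

Lemma dotE m (x y : 'rV[R]_m) : dot x y = \sum_j x ord0 j * y ord0 j.
Proof. by rewrite /dot mxE; apply: eq_bigr => j _; rewrite mxE. Qed.

Lemma dotC m (x y : 'rV[R]_m) : dot x y = dot y x.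
Proof. by rewrite !dotE; apply: eq_bigr => j _; rewrite mulrC. Qed.

Lemma dotDl m (x y z : 'rV[R]_m) : dot (x + y) z = dot x z + dot y z.
Proof. by rewrite /dot mulmxDl mxE. Qed.

Lemma dotZl m c (x z : 'rV[R]_m) : dot (c *: x) z = c * dot x z.
Proof. by rewrite /dot -scalemxAl mxE. Qed.

Lemma dotDr m (x y z : 'rV[R]_m) : dot x (y + z) = dot x y + dot x z.
Proof. by rewrite dotC dotDl ![dot _ x]dotC. Qed.

Lemma dotZr m c (x z : 'rV[R]_m) : dot x (c *: z) = c * dot x z.
Proof. by rewrite dotC dotZl dotC. Qed.

Lemma dot_pythagoras m c (x y : 'rV[R]_m) : dot x y = 0 ->
  dot (x + c *: y) (x + c *: y) = dot x x + c * c * dot y y.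
Proof.
by move=> xy; rewrite dotDl !dotDr !dotZl !dotZr [dot y x]dotC xy; ring.
Qed.

Lemma dot_ge0 m (x : 'rV[R]_m) : 0 <= dot x x.
Proof. by rewrite dotE sumr_ge0// => j _; rewrite -expr2 sqr_ge0. Qed.

Lemma dot_scalar m (x y : 'rV[R]_m) : x *m y^T = (dot x y)%:M.
Proof. by rewrite [LHS]mx11_scalar. Qed.

Lemma nearest_int (x : R) : exists z : int, `|x - z%:~R| <= 2^-1.
Proof.
exists (Num.floor (x + 2^-1)).
have := floor_itv (x + 2^-1) => /andP[].
rewrite intrD => h1 h2; rewrite ler_norml; apply/andP; split; lra.
Qed.

(** Smith normal form of a single row: an integer vector is a multiple of a member of a basis of the
    integer lattice. *)
Lemma row_unimodular k (v : 'rV[int]_k.+1) : exists2 U : 'M[int]_k.+1,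
  U \in unitmx & exists c : int, v = c *: row ord0 U.
Proof.
have [A _ [U uU [d _ ->]]] := int_Smith_normal_form v.
exists U => //; exists (A ord0 ord0 * d`_0).
rewrite -mulmxA [A]mx11_scalar mul_scalar_mx !mxE eqxx mulr1n -scalerA; congr (_ *: _).
apply/rowP => j; rewrite !mxE (bigD1 ord0)//= big1 ?addr0.
  by rewrite !mxE.
by move=> i i0; rewrite !mxE /= eq_sym -val_eqE /= in i0 *; rewrite (negPf i0) mul0r.
Qed.

(* Induction on the rank: project orthogonally to an almost shortest vector,
   which halves the squared minimum at worst. *)
Lemma covering k m (h : 'M[R]_(k, m)) (e : R) : 0 < e ->
  (forall v : 'rV[int]_k, v != 0 -> e <= dot (v%:r *m h) (v%:r *m h)) ->
  forall beta : 'cV[R]_k, exists d : 'rV[R]_m,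
    (exists z : 'cV[int]_k, h *m d^T = beta + z%:r) /\
    dot d d <= (2 ^+ k - 1) / e.
Proof.
elim: k m h e => [|k IH] m h e e0 he beta.
  exists 0; split; last by rewrite /dot mul0mx mxE expr0 subrr mul0r.
  by exists 0; apply/colP => -[].
pose A : set R := [set dot (v%:r *m h) (v%:r *m h) | v in [set v : 'rV[int]_k.+1 | v != 0]].
have A0 : A !=set0.
  exists (dot ((const_mx 1)%:r *m h) ((const_mx 1)%:r *m h)); exists (const_mx 1) => //=.
  by apply/eqP => /rowP /(_ ord0); rewrite !mxE.
have lbA : lbound A e by move=> _ [v v0 <-]; exact: he.
have infA : has_inf A by split => //; exists e.
pose lam := inf A.
have elam : e <= lam by apply: lb_le_inf.
have lamle v : v != 0 -> lam <= dot (v%:r *m h) (v%:r *m h).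
  by move=> v0; apply: ge_inf; [exists e|exists v].
have lam0 : 0 < lam by lra.
have [_ [v v0 <-] vlam] := inf_adherent lam0 infA.
(* As [c] is a nonzero integer, the basis vector [r] is no longer than the almost shortest [v], so
   its squared length [rho] lies between [lam] and 2 lam. *)
have [U uU [c vc]] := row_unimodular v.
have c0 : c != 0 by apply: contraNneq v0 => c0; rewrite vc c0 scale0r.
pose h2 : 'M[R]_(1 + k, m) := U%:r *m h.
pose r := usubmx h2; pose B := dsubmx h2.
have rE : r = (row ord0 U)%:r *m h.
  rewrite map_row -row_mul -/h2; apply/rowP => j; rewrite [LHS]mxE [RHS]mxE; congr (h2 _ _).
  exact/val_inj.
have h2E : h2 = col_mx r B by rewrite vsubmxK.
have h2v (w : 'rV[int]_(1 + k)) : w%:r *m h2 = (lsubmx w)%:r *m r + (rsubmx w)%:r *m B.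
  by rewrite h2E -{1}[w]hsubmxK map_row_mx mul_row_col.
clearbody B; pose rho := dot r r.
have row0 : row ord0 U != 0.
  by apply: contraNneq v0 => u0; rewrite vc u0 scaler0.
have rho1 : lam <= rho by rewrite /rho rE lamle.
have rho2 : rho < 2 * lam.
  have -> : 2 * lam = lam + lam by lra.
  apply: le_lt_trans vlam; rewrite vc.
  rewrite map_mxZ -scalemxAl -rE dotZl dotC dotZl mulrA ler_peMl ?dot_ge0//.
  have : (1 <= c * c)%R by move/eqP: c0; nia.
  by rewrite -(ler_int R) intrM.
have rho0 : 0 < rho by lra.
pose c0' := rho^-1 *: (B *m r^T).
pose h' := B - c0' *m r.
have h'r : h' *m r^T = 0.
  rewrite mulmxBl -mulmxA dot_scalar -/rho mul_mx_scalar scalerA.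
  by rewrite mulfV ?gt_eqF// scale1r subrr.
pose rd (y : R) := xchoose (nearest_int y).
have rdP y : `|y - (rd y)%:~R| <= 2^-1 by exact: (xchooseP (nearest_int y)).
have sq4 (y : R) : `|y| <= 2^-1 -> y * y <= 4^-1.
  by rewrite ler_norml => /andP[? ?]; nra.
have Uv (v' : 'rV[int]_(1 + k)) : v' != 0 -> lam <= dot (v'%:r *m h2) (v'%:r *m h2).
  move=> v'0; rewrite /h2 mulmxA -map_mxM lamle//.
  apply: contraNneq v'0 => e'; rewrite -[v']mulmx1 -(mulmxV uU) mulmxA e'.
  by rewrite mul0mx.
(* Lift [w] to a lattice vector whose component along [r] is at most half of [r]. Its squared length
   is at least [lam], and that component contributes at most rho / 4 < lam / 2. *)
have h'low w : w != 0 -> e / 2 <= dot (w%:r *m h') (w%:r *m h').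
  move=> w0; pose cc := (w%:r *m c0') ord0 ord0.
  pose a := rd cc; pose v' : 'rV[int]_(1 + k) := row_mx (const_mx (- a)) w.
  have v'0 : v' != 0.
    apply: contraNneq w0 => /(congr1 (@rsubmx _ 1 1 k)).
    by rewrite row_mxKr => ->; rewrite linear0.
  have := Uv v' v'0; rewrite h2v row_mxKl row_mxKr.
  have -> : (const_mx (- a) : 'rV_1)%:r *m r + w%:r *m B = w%:r *m h' + (cc - a%:~R) *: r.
    rewrite mulmxBr mulmxA [w%:r *m c0']mx11_scalar mul_scalar_mx -/cc.
    rewrite [(const_mx _)%:r]mx11_scalar mul_scalar_mx !mxE.
    by rewrite intrN scaleNr scalerBl addrA subrK addrC.
  have o : dot (w%:r *m h') r = 0 by rewrite /dot -mulmxA h'r mulmx0 mxE.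
  rewrite dot_pythagoras// -/rho.
  have := sq4 _ (rdP cc); rewrite -/a; move: (cc - _) => y y4.
  move: (dot _ _) => D; nra.
pose b2 : 'cV[R]_(1 + k) := U%:r *m beta.
(* The multiple [s] of [r] settles the first congruence; its effect on the other rows is subtracted
   from their target. Since [h'] annihilates [r], the component of [d'] along [r] can afterwards be
   discarded. *)
pose b0 := b2 ord0 ord0; pose s := (b0 - (rd b0)%:~R) / rho.
have [|d' [[z' h'd'] d'2]] := IH m h' (e / 2) _ h'low (dsubmx b2 - s *: (B *m r^T)).
  lra.
pose t := dot d' r / rho; pose p := d' - t *: r.
have pr : dot p r = 0.
  by rewrite dotDl -scaleNr dotZl mulNr divfK ?subrr// gt_eqF.
have d'E : d' = p + t *: r by rewrite subrK.
have pp : dot p p <= dot d' d'.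
  rewrite d'E dot_pythagoras// lerDl; apply: mulr_ge0; last exact: ltW.
  by rewrite -expr2 sqr_ge0.
exists (p + s *: r); split; last first.
  rewrite dot_pythagoras// -/rho.
  have : s * s * rho <= 4^-1 / e.
    have -> : s * s * rho = (b0 - (rd b0)%:~R) * (b0 - (rd b0)%:~R) / rho.
      by rewrite /s; field; rewrite gt_eqF.
    apply: ler_pM; [by rewrite -expr2 sqr_ge0|by rewrite invr_ge0 ltW|exact/sq4/rdP|].
    by rewrite lef_pV2 ?posrE//; lra.
  have e' : (2 ^+ k - 1) / (e / 2) = (2 ^+ k.+1 - 2) / e.
    by rewrite exprS; field; rewrite gt_eqF.
  rewrite e' in d'2; have ei : 0 < e^-1 by rewrite invr_gt0.
  have := le_trans pp d'2; move: (2 ^+ k.+1) => q; nra.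
have h2d : h2 *m (p + s *: r)^T = b2 + (col_mx (const_mx (- rd b0)) z')%:r.
  have rp : r *m (p + s *: r)^T = (s * rho)%:M.
    by rewrite dot_scalar dotC dotDl dotZl pr add0r.
  have Bp : B *m (p + s *: r)^T = dsubmx b2 + z'%:r.
    have -> : B = h' + c0' *m r by rewrite subrK.
    have trDZ c1 : h' *m (p + c1 *: r)^T = h' *m p^T.
      rewrite linearD /= linearZ /= mulmxDr -scalemxAr h'r.
      by rewrite scaler0 addr0.
    rewrite mulmxDl -mulmxA rp trDZ -(trDZ t) -d'E.
    rewrite h'd' mul_mx_scalar /c0' scalerA.
    by rewrite -mulrA mulfV ?gt_eqF// mulr1 addrAC subrK.
  rewrite h2E mul_col_mx rp Bp -[b2 in RHS]vsubmxK map_col_mx add_col_mx; congr col_mx.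
  have -> : usubmx b2 = b0%:M.
    rewrite [usubmx _]mx11_scalar mxE; congr scalar_mx; congr (fun_of_matrix b2 _ _).
    exact/val_inj.
  have -> : (const_mx (- rd b0) : 'M[int]_1)%:r = (- (rd b0)%:~R)%:M.
    by apply/matrixP => i j; rewrite !mxE !ord1 eqxx intrN mulr1n.
  by rewrite -raddfD /= /s divfK ?gt_eqF.
pose zz : 'cV[int]_k.+1 := @col_mx _ 1 k 1 (const_mx (- rd b0)) z'.
exists (invmx U *m zz).
have -> : h *m (p + s *: r)^T = (invmx U)%:r *m ((U%:r *m h) *m (p + s *: r)^T).
  by rewrite !mulmxA -map_mxM mulVmx// map_mx1 mul1mx.
have -> : (U%:r *m h) *m (p + s *: r)^T = U%:r *m beta + zz%:r by exact: h2d.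
by rewrite mulmxDr mulmxA -!map_mxM mulVmx// map_mx1 mul1mx.
Qed.

End Covering.

(** * Covolumes of primitive lattices *)

Section IntegerMinors.
Variable R : realType.
Local Notation "M '%:r'" := (map_mx intr M : 'M[R]_(_, _)) (at level 2, format "M %:r").

(* The maximum norm of the Pluecker coordinates of X: a choice of columns with
   repetitions contributes 0, and reordering does not change absolute values. *)
Definition minor_norm k m (X : 'M[R]_(k, m)) : R :=
  \big[Num.max/0]_(phi : {ffun 'I_k -> 'I_m}) `|\det (colsub phi X)|.

Lemma minor_norm_ge k m (X : 'M[R]_(k, m)) (phi : 'I_k -> 'I_m) :
  `|\det (colsub phi X)| <= minor_norm X.
Proof.
have -> : colsub phi X = colsub [ffun i => phi i] X.
  by apply: eq_colsub => i; rewrite ffunE.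
by rewrite /minor_norm (bigD1 [ffun i => phi i])//= le_max lexx.
Qed.

Lemma minor_norm_le k m (X : 'M[R]_(k, m)) c : 0 <= c ->
  (forall phi : 'I_k -> 'I_m, `|\det (colsub phi X)| <= c) -> minor_norm X <= c.
Proof. by move=> c0 Xc; rewrite /minor_norm; apply: bigmax_le => // phi _. Qed.

Lemma minor_norm_ge0 k m (X : 'M[R]_(k, m)) : 0 <= minor_norm X.
Proof. exact: bigmax_ge_id. Qed.

Lemma minor_norm_attained k m (X : 'M[R]_(k, m)) : 0 < minor_norm X ->
  exists phi : 'I_k -> 'I_m, minor_norm X = `|\det (colsub phi X)|.
Proof.
move=> X0; apply: contrapT => H; move: (X0); rewrite ltNge => /negP; apply.
have [phi] : exists phi : {ffun 'I_k -> 'I_m}, ~ (`|\det (colsub phi X)| < minor_norm X).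
  apply: contrapT => H'; move: (X0); rewrite /minor_norm => /[dup] X1.
  suff : minor_norm X < minor_norm X by rewrite ltxx.
  rewrite {1}/minor_norm; apply: bigmax_lt => // phi _.
  by apply: contrapT => ?; apply: H'; exists phi.
move=> /negP; rewrite -leNgt => le; exfalso; apply: H; exists phi.
by apply/eqP; rewrite eq_le le minor_norm_ge.
Qed.

Lemma minor_normMl k m (U : 'M[R]_k) (X : 'M[R]_(k, m)) :
  1 <= `|\det U| -> minor_norm X <= minor_norm (U *m X).
Proof.
move=> U1; apply: minor_norm_le; first exact: minor_norm_ge0.
move=> phi; apply: le_trans (minor_norm_ge _ phi).
by rewrite -mulmx_colsub det_mulmx normrM ler_peMl.
Qed.

Lemma minor_norm_square m (X : 'M[R]_m) : `|\det X| <= minor_norm X.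
Proof.
apply: le_trans (minor_norm_ge _ id).
by rewrite (_ : colsub id X = X)//; apply/matrixP => i j; rewrite mxE.
Qed.

(** Laplace expansion along the added row. *)
Lemma minor_norm_col_mx k m (v : 'rV[R]_m.+1) (X : 'M[R]_(k, m.+1)) (c : R) :
  (forall j, `|v ord0 j| <= c) ->
  minor_norm (col_mx v X) <= k.+1%:R * (c * minor_norm X).
Proof.
move=> vc; have X0 := minor_norm_ge0 X; apply: minor_norm_le.
  by rewrite mulr_ge0// mulr_ge0//; apply: le_trans (vc ord0).
move=> phi; rewrite (expand_det_row _ (ord0 : 'I_k.+1)).
apply: (le_trans (ler_norm_sum _ _ _)).
apply: (@le_trans _ _ (\sum_(j < k.+1) c * minor_norm X)); last first.
  by rewrite sumr_const card_ord -[X in X <= _]mulr_natl.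
apply: ler_sum => j _; rewrite normrM; apply: ler_pM => //.
  rewrite mxE (_ : ord0 = lshift k (ord0 : 'I_1)) ?col_mxEu//; exact/val_inj.
rewrite /cofactor normrM normrX normrN1 expr1n mul1r.
set Z : 'M[R]_k := (X in \det X).
have -> : Z = colsub (fun i => phi (lift j i)) X; last exact: minor_norm_ge.
apply/matrixP => i l; rewrite /Z [LHS]mxE [LHS]mxE [LHS]mxE [RHS]mxE.
have -> : lift ord0 i = rshift 1 i by apply: ord_inj; rewrite /= /bump.
by rewrite col_mxEd.
Qed.

Definition lat m := {k : nat & 'M[int]_(k, m)}.
Definition lat_mx m (s : lat m) : 'M[R]_(tag s, m) := (tagged s)%:r.
(** Real spans are compared; they determine primitive lattices. *)
Definition lat_cmp m (s t : lat m) : Prop :=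
  (lat_mx s <= lat_mx t)%MS || (lat_mx t <= lat_mx s)%MS.

(* The rows of s form a basis of the integer points of their real span. *)
Definition primitive m (s : lat m) : Prop := row_free (lat_mx s) /\
  forall (t : 'M[int]_(tag s, m)) (U : 'M[R]_(tag s)),
    t%:r = U *m lat_mx s -> \det U != 0 -> 1 <= `|\det U|.

Lemma lat_cmp_refl m (s : lat m) : lat_cmp s s.
Proof. by rewrite /lat_cmp submx_refl. Qed.

Lemma lat_cmp_sym m (s t : lat m) : lat_cmp s t -> lat_cmp t s.
Proof. by rewrite /lat_cmp orbC. Qed.

Lemma det_intr k (M : 'M[int]_k) : \det M%:r = (\det M)%:~R.
Proof. exact: det_map_mx. Qed.

Lemma norm_intr_ge1 (z : int) : z%:~R != 0 :> R -> 1 <= `|z%:~R : R|.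
Proof.
rewrite intr_eq0 -intr_norm => z0.
have : (1 <= `|z|)%R by lia.
by rewrite -(ler_int R).
Qed.

Lemma row_free_minor k m (M : 'M[R]_(k, m)) : row_free M ->
  exists phi : 'I_k -> 'I_m, \det (colsub phi M) != 0.
Proof.
move=> rM; have rMT : row_full M^T by rewrite /row_full mxrank_tr.
exists (fullrankfun rMT); have := fullrowsub_unit rMT.
by rewrite unitmxE unitfE -det_tr trmx_mxsub trmxK.
Qed.

Lemma det_colsubMl k m (U : 'M[R]_k) (X : 'M[R]_(k, m)) (phi : 'I_k -> 'I_m) :
  \det (colsub phi (U *m X)) = \det U * \det (colsub phi X).
Proof. by rewrite -mulmx_colsub det_mulmx. Qed.

Lemma det_colsub_intr k m (M : 'M[int]_(k, m)) (phi : 'I_k -> 'I_m) :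
  \det (colsub phi M%:r) = (\det (colsub phi M))%:~R.
Proof. by rewrite -map_mxsub det_intr. Qed.

(** Among the integer matrices with the same real span, take one whose [phi]-minor has the least
    nonzero absolute value: a change of basis multiplies that minor by its determinant. *)
Lemma primitive_closure k m (M0 : 'M[int]_(k, m)) : row_free M0%:r ->
  exists M : 'M[int]_(k, m), primitive (existT _ k M) /\
    exists2 U : 'M[R]_k, 1 <= `|\det U| & M0%:r = U *m M%:r.
Proof.
move=> fM0; have [phi Mphi] := row_free_minor fM0.
pose Q p := `[< exists M : 'M[int]_(k, m), exists2 U : 'M[R]_k, \det U != 0 &
   M%:r = U *m M0%:r /\ p = absz (\det (colsub phi M)) >].
have exQ : exists p, Q p.
  exists (absz (\det (colsub phi M0))); apply/asboolP; exists M0; exists 1%:M.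
    by rewrite det1 oner_eq0.
  by rewrite mul1mx.
case: (ex_minnP exQ) => p /asboolP[M [U U0 [MU pE]]] pmin.
have absd (N : 'M[int]_(k, m)) :
    `|\det (colsub phi N%:r)| = (absz (\det (colsub phi N)))%:R :> R.
  by rewrite det_colsub_intr -intr_norm -abszE.
have pM : primitive (existT _ k M).
  split.
    rewrite /lat_mx /= MU /row_free eqmxMfull//.
    by rewrite row_full_unit unitmxE unitfE.
  move=> t U' /= tU' U'0.
  have : (p <= absz (\det (colsub phi t)))%N.
    apply: pmin; apply/asboolP; exists t; exists (U' *m U).
      by rewrite det_mulmx mulf_neq0.
    by rewrite -mulmxA -MU.
  rewrite -(ler_nat R) pE -!absd tU' det_colsubMl normrM.
  rewrite -{1}[`|\det (colsub phi _)|]mul1r ler_pM2r// normr_gt0 MU det_colsubMl.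
  by rewrite mulf_neq0.
exists M; split => //; exists (invmx U).
  apply: (pM.2 M0); rewrite /lat_mx /=.
    by rewrite MU mulmxA mulVmx ?mul1mx// unitmxE unitfE.
  by rewrite det_inv invr_eq0.
by rewrite MU mulmxA mulVmx ?mul1mx// unitmxE unitfE.
Qed.

(** Let [v] be short, [V] the member of the flag (or 0) of largest rank whose span misses [v], and
    [W] the primitive closure of [V] and [v]; its covolume is below [delta]. Members whose span
    contains [v] contain [W], the others lie in [V], so [W] is comparable with the whole flag. Hence
    it extends the flag, or has the same span as a member, or has full rank, and its covolume is at
    least [delta] in each case. *)
Lemma flag_short_vector n (h : 'M[R]_n.+1) (delta : R) (S : seq (lat n.+1)) :
  1 <= `|\det h| -> 0 < delta <= 1 ->
  flag (@primitive n.+1) (fun s => tag s) (@lat_cmp n.+1) n S ->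
  {in S, forall s, delta <= minor_norm (lat_mx s *m h) <= 1} ->
  (forall s, extends_flag (@primitive n.+1) (fun s => tag s) (@lat_cmp n.+1) n S s ->
     1 <= minor_norm (lat_mx s *m h)) ->
  forall v : 'rV[int]_n.+1, v != 0 ->
  exists j, delta / n.+1%:R <= `|(v%:r *m h) ord0 j|.
Proof.
move=> h1 /andP[d0 d1] fS Sz ext v v0; apply: contrapT => H.
have vh j : `|(v%:r *m h) ord0 j| <= delta / n.+1%:R.
  by rewrite leNgt; apply/negP => /ltW ?; apply: H; exists j.
have vh' : exists2 c, 0 <= c < delta / n.+1%:R & forall j, `|(v%:r *m h) ord0 j| <= c.
  exists (\big[Num.max/0]_j `|(v%:r *m h) ord0 j|); last first.
    by move=> j; rewrite (bigD1 j)//= le_max lexx.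
  apply/andP; split; first exact: bigmax_ge_id.
  apply: bigmax_lt => [|j _]; first by rewrite divr_gt0.
  by rewrite ltNge; apply/negP => ?; apply: H; exists j.
move: vh' => [c /andP[c0 cd] vc] {H vh}.
have [uS okS cS] := fS.
(* The zero lattice, whose empty determinant is 1, serves when every member of [S] contains [v]. *)
pose s0 : lat n.+1 := existT _ 0%N (const_mx 0).
pose P k := has (fun s : lat n.+1 => (tag s == k) && ~~ (v%:r <= lat_mx s)%MS) (s0 :: S).
have vr0 : v%:r != 0.
  apply: contraNneq v0 => /matrixP e; apply/eqP/matrixP => i j.
  by have /eqP := e i j; rewrite !mxE intr_eq0 => /eqP.
have exP : exists k, P k.
  exists 0%N; rewrite /P /=.
  apply/orP; left; apply/negP => /mxrankS/leq_trans/(_ (rank_leq_row _)).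
  by rewrite leqn0 mxrank_eq0 (negPf vr0).
have okS0 s : s \in s0 :: S -> [/\ row_free (lat_mx s), (tag s <= n)%N,
    minor_norm (lat_mx s *m h) <= 1 & forall t, t \in S -> lat_cmp s t].
  rewrite inE => /predU1P[->|sS].
    have e0 : lat_mx s0 = 0 by apply/matrixP => -[].
    split => //; first by rewrite /row_free e0 mxrank0.
      apply: minor_norm_le => // phi.
      by rewrite det_mx00 normr1.
    by move=> t tS; rewrite /lat_cmp e0 sub0mx.
  have [[fs _] /andP[_ sn]] := okS s sS; split => //.
    by have /andP[] := Sz s sS.
  by move=> t tS; apply: cS.
have leP k : P k -> (k <= n.+1)%N.
  by move=> /hasP[s sS /andP[/eqP <- _]]; have [_ /leqW] := okS0 s sS.
case: (ex_maxnP exP leP) => k /hasP[[k' V] sS /= /andP[/eqP kk' vV]] kmax.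
rewrite {k'}kk' in V sS vV.
have [fV kn V1 cV] := okS0 _ sS; rewrite /lat_mx /= in fV kn V1 vV.
pose W0 : 'M[int]_(1 + k, n.+1) := col_mx v V.
have W0E : W0%:r = col_mx v%:r V%:r by rewrite map_col_mx.
have VW0 : (V%:r <= W0%:r)%MS by rewrite W0E -addsmxE addsmxSr.
have vW0 : (v%:r <= W0%:r)%MS by rewrite W0E -addsmxE addsmxSl.
have fW0 : row_free W0%:r.
  have : (V%:r < W0%:r)%MS.
    rewrite ltmxE VW0; apply: contra vV => /(submx_trans vW0)//.
  move=> /rank_ltmx; rewrite (eqP fV) => kr.
  by rewrite /row_free eqn_leq rank_leq_row.
have [W [pW [U U1 W0U]]] := primitive_closure fW0.
have U0 : \det U != 0 by rewrite -normr_gt0; lra.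
have WW0 : (W0%:r :=: W%:r)%MS.
  by rewrite W0U; apply: eqmxMfull; rewrite row_full_unit unitmxE unitfE.
have psiW : minor_norm (W%:r *m h) < delta.
  apply: (@le_lt_trans _ _ (minor_norm (W0%:r *m h))).
    by rewrite W0U -mulmxA; exact: minor_normMl.
  rewrite W0E mul_col_mx; apply: (le_lt_trans (minor_norm_col_mx _ vc)).
  have n0 : 0 < n.+1%:R :> R by [].
  rewrite ltr_pdivlMr// in cd.
  have kn' : k.+1%:R <= n.+1%:R :> R by rewrite ler_nat.
  have c' : c * minor_norm (V%:r *m h) <= c by rewrite ler_piMr.
  apply: (@le_lt_trans _ _ (n.+1%:R * c)); last by rewrite mulrC.
  by apply: ler_pM => //; rewrite mulr_ge0// minor_norm_ge0.
suff : delta <= minor_norm (W%:r *m h) by rewrite leNgt psiW.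
have cW t : t \in S -> lat_cmp (existT _ (1 + k)%N W) t.
  move=> tS; rewrite /lat_cmp /lat_mx /= -!WW0.
  have := cV t tS; rewrite /lat_cmp /lat_mx /=.
  have [vt|vt] := boolP (v%:r <= (tagged t)%:r)%MS.
    move=> /orP[Vt|tV]; last by rewrite (submx_trans vt tV) in vV.
    by rewrite W0E col_mx_sub vt Vt.
  have tk : (tag t <= k)%N.
    by apply: kmax; apply/hasP; exists t; rewrite ?inE ?tS ?orbT// eqxx.
  move=> Vt; suff tV : ((tagged t)%:r <= V%:r)%MS.
    by rewrite (submx_trans tV VW0) orbT.
  move: Vt => /orP[Vt|//]; have [[ft _] _] := okS t tS.
  have := mxrank_leqif_sup Vt; rewrite (eqP fV) (eqP ft) => -[kt <-].
  by rewrite eqn_leq kt.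
have [kn1|kn1] := eqVneq k n.
  subst k; apply: (le_trans d1); apply: le_trans (minor_norm_square _).
  rewrite det_mulmx normrM mulr_ege1// det_intr norm_intr_ge1//.
  rewrite -det_intr -unitfE -unitmxE -row_free_unit.
  by case: pW.
have {}kn : (k < n)%N by rewrite ltn_neqAle kn1.
have [/mapP[t tS kt]|kS] := boolP (1 + k \in map (fun s : lat n.+1 => tag s) S)%N.
  have /andP[dt _] := Sz t tS; apply: (le_trans dt).
  have [pt _] := okS t tS; have ct := cW t tS.
  case: t kt {tS dt} pt ct => kt Mt /= kkt; rewrite -{kt}kkt in Mt * => pt ct.
  have [U' WU'] : exists U', W%:r = U' *m Mt%:r.
    apply/submxP; have [fM _] := pt; have [fW _] := pW.
    move: ct => /orP[//|]; rewrite /lat_mx /= => MW.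
    have := mxrank_leqif_sup MW; rewrite (eqP fW) (eqP fM) => -[_ <-].
    by rewrite eqxx.
  rewrite /lat_mx /= WU' -mulmxA; apply: minor_normMl; apply: (pt.2 W) => //.
  have [fW _] := pW; move: fW; rewrite /lat_mx /= WU'.
  have [fM _] := pt; rewrite /row_free mxrankMfree// -/(row_free U') row_free_unit.
  by rewrite unitmxE unitfE.
apply: (le_trans d1); apply: (ext (existT _ (1 + k)%N W)); split => // t tS.
split; first exact: cW.
by move=> /= e; move/negP: kS; apply; rewrite e; apply: map_f tS.
Qed.

End IntegerMinors.

(** * Nondivergence along a nondegenerate curve *)

Section Flow.
Variables (R : realType) (n : nat).
Implicit Types (F : 'I_n.+1 -> nat -> R -> R) (tau T : 'I_n.+1 -> R) (x : R).
Local Notation "M '%:r'" := (map_mx intr M : 'M[R]_(_, _)) (at level 2, format "M %:r").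

(* Rows and columns are indexed by 0 (the denominator q) and by lift ord0 i for
   the coordinate i.  Column ord0 of the lower right block is the direction of
   the tangent vector. *)
Definition curve_mx F tau x : 'M[R]_n.+2 := \matrix_(i, j)
  match unlift ord0 i, unlift ord0 j with
  | None, None => 1
  | None, Some _ => 0
  | Some i', None => F i' 0 x
  | Some i', Some j' => (i' == j')%:R + tau i' * (j' == ord0)%:R
  end.

(** The diagonal flow; the factor of column 0 keeps its determinant equal to 1. *)
Definition scaling T : 'rV[R]_n.+2 := \row_j
  if unlift ord0 j is Some j' then (T j')^-1 else \prod_j T j.

Definition flow_mx F tau T x := curve_mx F tau x *m diag_mx (scaling T).

Lemma mul_curve_mx0 F tau x k (M : 'M[R]_(k, n.+2)) r :
  (M *m curve_mx F tau x) r ord0 =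
  M r ord0 + \sum_i M r (lift ord0 i) * F i 0 x.
Proof.
rewrite mxE big_ord_recl mxE unlift_none mulr1; congr (_ + _).
by apply: eq_bigr => i _; rewrite mxE unlift_none liftK.
Qed.

Lemma mul_curve_mxS F tau x k (M : 'M[R]_(k, n.+2)) r j :
  (M *m curve_mx F tau x) r (lift ord0 j) =
  M r (lift ord0 j) + (j == ord0)%:R * \sum_i tau i * M r (lift ord0 i).
Proof.
rewrite mxE big_ord_recl mxE unlift_none liftK mulr0 add0r.
rewrite (eq_bigr (fun i => M r (lift ord0 i) * (i == j)%:R +
    (j == ord0)%:R * (tau i * M r (lift ord0 i)))).
  rewrite big_split /= -mulr_sumr; congr (_ + _).
  rewrite (bigD1 j)//= eqxx mulr1 big1 ?addr0// => i /negPf ->.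
  by rewrite mulr0.
by move=> i _; rewrite mxE !liftK; ring.
Qed.

Lemma det_curve_mx F tau x : tau ord0 = 0 -> \det (curve_mx F tau x) = 1.
Proof.
move=> t0; rewrite det_trig; last first.
  apply/is_trig_mxP => i j; rewrite mxE.
  case: unliftP => [i' ->|->]; case: unliftP => [j' ->|->] //=.
  rewrite /bump /= !add1n ltnS => ij.
  have -> : (i' == j') = false by apply/negP => /eqP e; rewrite e ltnn in ij.
  have -> : (j' == ord0) = false by apply/negP => /eqP e; rewrite e in ij.
  by rewrite mulr0 addr0.
apply: big1 => i _; rewrite mxE; case: unliftP => //= j _.
rewrite eqxx; case: eqP => [->|_]; first by rewrite t0 mul0r addr0.
by rewrite mulr0 addr0.
Qed.

Lemma scaling_gt0 T j : (forall i, 0 < T i) -> 0 < scaling T ord0 j.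
Proof.
by move=> T0; rewrite mxE; case: unlift => [i|]; rewrite ?invr_gt0// prodr_gt0.
Qed.

Lemma det_flow_mx F tau T x : tau ord0 = 0 -> (forall i, 0 < T i) ->
  \det (flow_mx F tau T x) = 1.
Proof.
move=> t0 T0; rewrite det_mulmx det_curve_mx// mul1r det_diag big_ord_recl.
rewrite mxE unlift_none.
have -> : \prod_(i < n.+1) scaling T 0 (lift ord0 i) = \prod_i (T i)^-1.
  by apply: eq_bigr => i _; rewrite mxE liftK.
by rewrite prodfV divff//; apply/prodf_neq0 => i _; rewrite gt_eqF.
Qed.

Lemma det_colsub_flow F tau T x k (M : 'M[R]_(k, n.+2)) (phi : 'I_k -> 'I_n.+2) :
  \det (colsub phi (M *m flow_mx F tau T x)) =
  (\prod_i scaling T ord0 (phi i)) * \det (colsub phi (M *m curve_mx F tau x)).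
Proof.
rewrite mulmxA mul_mx_diag.
rewrite (_ : colsub _ _ = colsub phi (M *m curve_mx F tau x) *m
    diag_mx (\row_i scaling T ord0 (phi i))).
  by rewrite det_mulmx det_diag [RHS]mulrC; congr (_ * _); apply: eq_bigr => i _; rewrite mxE.
by apply/matrixP => i j; rewrite mul_mx_diag !mxE.
Qed.

Lemma det_colsub_inj k m (X : 'M[R]_(k, m)) (phi : 'I_k -> 'I_m) :
  \det (colsub phi X) != 0 -> injective phi.
Proof.
move=> /negP d i j e; apply: contrapT => /eqP ij; apply: d.
rewrite -det_tr (determinant_alternate ij)// => l.
by rewrite !mxE e.
Qed.

Definition replace_col k (A : 'M[R]_k) (i0 : 'I_k) (y : 'I_k -> R) : 'M[R]_k :=
  \matrix_(r, i) if i == i0 then y r else A r i.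

Lemma det_replace_col k (A : 'M[R]_k) i0 y :
  \det (replace_col A i0 y) = \sum_r y r * cofactor A r i0.
Proof.
rewrite (expand_det_col _ i0); apply: eq_bigr => r _; rewrite mxE eqxx.
congr (_ * (_ * \det _)); apply/matrixP => i j; rewrite !mxE.
by rewrite eq_sym (negPf (neq_lift _ _)).
Qed.

(** Only column 0 of [curve_mx] depends on the parameter, so the cofactors along it may be taken at
    any fixed [x]. *)
Lemma det_affine F tau x k (M : 'M[R]_(k, n.+2)) (phi : 'I_k -> 'I_n.+2) i0 :
  phi i0 = ord0 -> (forall i, i != i0 -> phi i != ord0) ->
  forall y, let cof r := cofactor (colsub phi (M *m curve_mx F tau x)) r i0 in
  \det (colsub phi (M *m curve_mx F tau y)) =
  affine_comb F (\sum_r M r ord0 * cof r)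
    (fun j => \sum_r M r (lift ord0 j) * cof r) y.
Proof.
move=> p0 pn y cof; pose A := colsub phi (M *m curve_mx F tau x).
have -> : colsub phi (M *m curve_mx F tau y) =
    replace_col A i0 (fun r => (M *m curve_mx F tau y) r ord0).
  apply/matrixP => r i; rewrite [LHS]mxE [RHS]mxE; case: eqP => [->|/eqP ii0].
    by rewrite p0.
  rewrite [RHS]mxE; have := pn i ii0; case: (unliftP ord0 (phi i)) => [j ->|->].
    by rewrite !mul_curve_mxS.
  by rewrite eqxx.
rewrite det_replace_col /affine_comb.
rewrite (eq_bigr (fun r => M r ord0 * cof r + \sum_j (M r (lift ord0 j) * cof r) * F j 0 y)).
  rewrite big_split /=; congr (_ + _); rewrite exchange_big /=.
  by apply: eq_bigr => j _; rewrite mulr_suml.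
move=> r _; rewrite mul_curve_mx0 mulrDl; congr (_ + _).
by rewrite mulr_suml; apply: eq_bigr => j _; rewrite mulrAC.
Qed.

(** A repeated column gives 0, and a choice without column 0 gives a constant. *)
Lemma det_colsub_curve_affine F tau k (M : 'M[R]_(k, n.+2)) (phi : 'I_k -> 'I_n.+2) :
  exists c0 c, forall x,
  \det (colsub phi (M *m curve_mx F tau x)) = affine_comb F c0 c x.
Proof.
have [/injectiveP inj|ninj] := boolP (injectiveb phi); last first.
  exists 0, (fun=> 0) => x; apply/eqP; rewrite /affine_comb big1 ?addr0.
    by apply: contraR ninj => /det_colsub_inj/injectiveP.
  by move=> i _; rewrite mul0r.
have [[i0 p0]|np0] := pselect (exists i0, phi i0 = ord0).
  do 2 eexists; move=> x; apply: (@det_affine F tau 0 _ M phi i0) => // i.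
  by apply: contra_neq => pi; apply: inj; rewrite p0.
exists (\det (colsub phi (M *m curve_mx F tau 0))), (fun=> 0) => x.
rewrite /affine_comb big1 ?addr0; last by move=> i _; rewrite mul0r.
congr (\det _); apply/matrixP => r i; rewrite [LHS]mxE [RHS]mxE.
case: (unliftP ord0 (phi i)) => [j ->|p0]; last by case: np0; exists i.
by rewrite !mul_curve_mxS.
Qed.

(* If some nonzero minor of M avoids column 0 or the tangent column, replace one
   of its columns by column 0; otherwise the correction terms coming from the
   tangent column are minors that vanish. *)
Lemma integral_coefficient F tau x k (M : 'M[int]_(k.+1, n.+2)) :
  tau ord0 = 0 -> row_free M%:r ->
  exists phi i0 j, [/\ phi i0 = ord0, forall i, i != i0 -> phi i != ord0 &
   1 <= `| \sum_r M%:r r j * cofactor (colsub phi (M%:r *m curve_mx F tau x)) r i0 |].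
Proof.
move=> t0 fM; set s : 'I_n.+2 := lift ord0 ord0.
have colE y (phi : 'I_k.+1 -> 'I_n.+2) i r : phi i != ord0 -> phi i != s ->
    (M%:r *m curve_mx F tau y) r (phi i) = M%:r r (phi i).
  case: (unliftP ord0 (phi i)) => [j ->|->]; last by rewrite eqxx.
  move=> _; rewrite (inj_eq lift_inj) => /negPf j0.
  by rewrite mul_curve_mxS j0 mul0r addr0.
have good (phi : 'I_k.+1 -> 'I_n.+2) i0 : \det (colsub phi M%:r) != 0 ->
    (forall i, i != i0 -> (phi i != ord0) && (phi i != s)) ->
    exists phi i0 j, [/\ phi i0 = ord0, forall i, i != i0 -> phi i != ord0 &
   1 <= `| \sum_r M%:r r j * cofactor (colsub phi (M%:r *m curve_mx F tau x)) r i0 |].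
  move=> d H; exists (fun i => if i == i0 then ord0 else phi i), i0, (phi i0); split.
  - by rewrite eqxx.
  - by move=> i ii0; rewrite (negPf ii0); have /andP[] := H i ii0.
  rewrite -det_replace_col (_ : replace_col _ _ _ = colsub phi M%:r).
    by rewrite det_colsub_intr in d *; exact: norm_intr_ge1.
  apply/matrixP => r i; rewrite [LHS]mxE [RHS]mxE; case: (eqVneq i i0) => [->//|ii0].
  rewrite mxE (negPf ii0); apply: colE; by have /andP[] := H i ii0.
have [phi d] := row_free_minor fM.
apply: contrapT => no.
have {}good (p : 'I_k.+1 -> 'I_n.+2) i0 :
    (forall i, i != i0 -> (p i != ord0) && (p i != s)) -> \det (colsub p M%:r) = 0.
  by move=> H; apply/eqP; apply: contrapT => /negP d'; apply: no; exact: good H.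
have inj := det_colsub_inj d.
have [i0 p0] : exists i0, phi i0 = ord0.
  apply: contrapT => np0.
  have np i : phi i != ord0 by apply/eqP => ?; apply: np0; exists i.
  have [[i1 p1]|np1] := pselect (exists i1, phi i1 = s).
    move/eqP: d; apply; apply: (good phi i1) => i ii1; rewrite np /=.
    by apply: contra_neq ii1 => pi; apply: inj; rewrite p1.
  move/eqP: d; apply; apply: (good phi ord0) => i _; rewrite np /=.
  by apply/eqP => ?; apply: np1; exists i.
have pn i : i != i0 -> phi i != ord0.
  by apply: contra_neq => pi; apply: inj; rewrite p0.
have [i1 p1] : exists i1, phi i1 = s.
  apply: contrapT => np1; move/eqP: d; apply; apply: (good phi i0) => i ii0.
  by rewrite pn//=; apply/eqP => ?; apply: np1; exists i.
have i10 : i1 != i0.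
  by apply/eqP => e; move: p1; rewrite e p0 => /eqP; rewrite eq_liftF.
apply: no; exists phi, i0, ord0; split => //.
rewrite -det_replace_col.
suff -> : \det (replace_col (colsub phi (M%:r *m curve_mx F tau x)) i0
    (fun r => M%:r r ord0)) = \det (colsub phi M%:r).
  by rewrite det_colsub_intr in d *; exact: norm_intr_ge1.
have -> : replace_col (colsub phi (M%:r *m curve_mx F tau x)) i0 (fun r => M%:r r ord0)
    = replace_col (colsub phi M%:r) i1
      (fun r => M%:r r s + \sum_i tau i * M%:r r (lift ord0 i)).
  apply/matrixP => r i; rewrite [LHS]mxE [RHS]mxE.
  have [->|ii0] := eqVneq i i0.
    by rewrite eq_sym (negPf i10) [RHS]mxE p0.
  rewrite [LHS]mxE /=; have [->|ii1] := eqVneq i i1.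
    by rewrite p1 mul_curve_mxS eqxx mul1r.
  rewrite [RHS]mxE; apply: colE; first exact: pn.
  by apply: contra_neq ii1 => pi; apply: inj; rewrite p1.
rewrite det_replace_col.
under eq_bigr do rewrite mulrDl mulr_suml.
rewrite big_split /= exchange_big /= [X in _ + X]big1 ?addr0.
  rewrite -det_replace_col; congr (\det _); apply/matrixP => r i; rewrite [LHS]mxE.
  by case: eqP => // ->; rewrite [RHS]mxE p1.
move=> i _; under eq_bigr do rewrite -mulrA.
rewrite -mulr_sumr -det_replace_col; have [->|ii] := eqVneq i ord0.
  by rewrite t0 mul0r.
pose p j := if j == i1 then lift ord0 i else phi j.
rewrite (_ : replace_col _ _ _ = colsub p M%:r); last first.
  by apply/matrixP => r j; rewrite [LHS]mxE [RHS]mxE /p; case: eqP => // _; rewrite mxE.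
rewrite (good p i0) ?mulr0// => j ji0; rewrite /p; case: (eqVneq j i1) => [_|ji1].
  by rewrite eq_sym neq_lift /= (inj_eq lift_inj).
by rewrite pn//=; apply: contra_neq ji1 => pj; apply: inj; rewrite p1.
Qed.

End Flow.

Section CurveNondivergence.
Variables (R : realType) (n : nat).
Implicit Types (F : 'I_n.+1 -> nat -> R -> R) (tau T : 'I_n.+1 -> R).
Local Notation "M '%:r'" := (map_mx intr M : 'M[R]_(_, _)) (at level 2, format "M %:r").

(** At most n + 1 of the n + 2 columns are chosen, column 0 among them, so some other column is
    missing and its factor [T j] in the product attached to column 0 is not cancelled. *)
Lemma prod_scaling_ge T Tmin k (phi : 'I_k -> 'I_n.+2) i0 :
  (k <= n.+1)%N -> injective phi -> phi i0 = ord0 ->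
  (forall i, 1 <= T i) -> (forall i, Tmin <= T i) ->
  Tmin <= \prod_i scaling T ord0 (phi i).
Proof.
move=> kn inj p0 T1 TTmin.
pose I := [set phi i | i in [set: 'I_k]]%SET.
have <- : \prod_(j in I) scaling T ord0 j = \prod_i scaling T ord0 (phi i).
  rewrite big_imset; last by move=> ? ? _ _; apply: inj.
  by apply: eq_bigl => i; rewrite inE.
have I0 : ord0 \in I by apply/imsetP; exists i0.
rewrite big_mkcond big_ord_recl /= I0 {1}/scaling mxE unlift_none -big_split /=.
have [j Ij] : exists j : 'I_n.+1, lift ord0 j \notin I.
  apply: contrapT => H.
  have : [set: 'I_n.+2]%SET \subset I.
    apply/fintype.subsetP => j _; case: (unliftP ord0 j) => [j' ->|->//].
    by apply: contrapT => /negP ?; apply: H; exists j'.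
  move=> /subset_leq_card; rewrite cardsT card_ord card_imset// cardsT card_ord.
  by rewrite ltnNge kn.
have fac i : 1 <= T i * (if lift ord0 i \in I then scaling T ord0 (lift ord0 i) else 1).
  case: ifP => _; last by rewrite mulr1.
  by rewrite mxE liftK divff// gt_eqF//; apply: lt_le_trans (T1 i).
rewrite (bigD1 j)//= (negPf Ij) mulr1.
apply: (le_trans (TTmin j)); rewrite ler_peMr//; first by apply: le_trans (T1 j).
elim/big_ind: _ => // x y x1 y1; exact: mulr_ege1.
Qed.

(** By [integral_coefficient] a minor through column 0 has a coefficient of absolute value at least
    1, so it reaches [rho] on [u, v], and the scaling multiplies it by at least 1 / rho. Neither
    [rho] nor [Tmin] depends on [tau]. *)
Lemma flow_high l F a b K kap u v :
  chart l F a b K kap -> a < u -> u < v -> v < b ->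
  exists2 Tmin, 1 <= Tmin & forall T tau, tau ord0 = 0 -> (forall i, Tmin <= T i) ->
    forall s : lat n.+2, primitive R s -> (1 <= tag s <= n.+1)%N ->
    exists2 z, u <= z <= v & 1 <= minor_norm (lat_mx R s *m flow_mx F tau T z).
Proof.
move=> ch au uv vb; have [rho rho0 Frho] := affine_comb_lower ch au uv vb.
exists (Num.max 1 rho^-1); first by rewrite le_max lexx.
move=> T tau t0 TTmin [[|k] M] [fM _] //= kn; rewrite /lat_mx /= in fM *.
have T1 i : 1 <= T i by apply: le_trans (TTmin i); rewrite le_max lexx.
have Tpos i : 0 < T i by apply: lt_le_trans (T1 i).
have Trho i : rho^-1 <= T i by apply: le_trans (TTmin i); rewrite le_max lexx orbT.
have [phi [i0 [j [p0 pn D1]]]] := integral_coefficient F 0 t0 fM.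
pose c0 r := cofactor (colsub phi (M%:r *m curve_mx F tau 0)) r i0.
have {}D1 : 1 <= `|\sum_r M%:r r j * c0 r| by [].
have detE y : \det (colsub phi (M%:r *m curve_mx F tau y)) =
    affine_comb F (\sum_r M%:r r ord0 * c0 r)
      (fun j => \sum_r M%:r r (lift ord0 j) * c0 r) y.
  exact: det_affine.
have [z zuv [z0 zi]] := Frho (\sum_r M%:r r ord0 * c0 r)
  (fun j => \sum_r M%:r r (lift ord0 j) * c0 r).
exists z => //; apply: le_trans (minor_norm_ge _ phi).
rewrite det_colsub_flow normrM detE.
have D : rho <= `|affine_comb F (\sum_r M%:r r ord0 * c0 r)
    (fun j => \sum_r M%:r r (lift ord0 j) * c0 r) z|.
  move: D1; case: (unliftP ord0 j) => [j' ->|->] D1.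
    by apply: le_trans (zi j'); rewrite ler_peMr// ltW.
  by apply: le_trans z0; rewrite ler_peMr// ltW.
have d0 : 0 < `|\det (colsub phi (M%:r *m curve_mx F tau z))|.
  by rewrite detE; apply: lt_le_trans D.
have inj : injective phi by move: d0; rewrite normr_gt0 => /det_colsub_inj.
have := @prod_scaling_ge T rho^-1 _ phi i0 kn inj p0 T1 Trho.
move: (\prod_i _) => P PT.
apply: (@le_trans _ _ (rho^-1 * rho)); first by rewrite mulVf// gt_eqF.
apply: ler_pM; [by rewrite invr_ge0 ltW|exact: ltW| |exact: D].
exact: le_trans PT (ler_norm _).
Qed.

Lemma loss_linear (eta : R) r : loss eta r = eta * loss 1 r.
Proof. by elim: r => [|r IH] /=; rewrite ?mulr0// IH; ring. Qed.

(** The order of the quantifiers matters: [eps] depends on the chart alone, [Tmin] also on the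
    interval but not on [tau]. *)
Lemma curve_nondivergence l F a b K kap : chart l F a b K kap ->
  exists2 eps, 0 < eps & forall u v, a < u -> u < v -> v < b ->
  exists2 Tmin, 1 <= Tmin & forall T tau, tau ord0 = 0 -> (forall i, Tmin <= T i) ->
  small [set x | u <= x <= v /\ exists2 p : 'rV[int]_n.+2, p != 0 &
     forall j, `|(p%:r *m flow_mx F tau T x) ord0 j| < eps] ((v - u) / 2).
Proof.
move=> ch; pose lo := loss (1 : R) n.+1.
have lo0 : 0 <= lo by apply: loss_ge0.
(* As [loss] is linear in [eta], this value keeps the total loss below 1/2. *)
pose eta := (2 * (lo + 1))^-1.
have eta0 : 0 < eta by rewrite invr_gt0; lra.
have [delta /andP[d0 d1] Fgood] := affine_comb_good ch eta0.
exists (delta / n.+2%:R); first by rewrite divr_gt0.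
move=> u v au uv vb; have [Tmin Tmin1 Fhigh] := flow_high ch au uv vb.
exists Tmin => // T tau t0 TTmin.
have Tpos i : 0 < T i by apply: lt_le_trans (TTmin i); lra.
pose psi (s : lat n.+2) x := minor_norm (lat_mx R s *m flow_mx F tau T x).
have detaff (s : lat n.+2) phi : exists P c0 c, 0 < P /\ forall x,
    `|\det (colsub phi (lat_mx R s *m flow_mx F tau T x))| = P * `|affine_comb F c0 c x|.
  have [c0 [c cE]] := det_colsub_curve_affine F tau (lat_mx R s) phi.
  exists (\prod_i scaling T ord0 (phi i)), c0, c.
  have P0 : 0 < \prod_i scaling T ord0 (phi i).
    by apply: prodr_gt0 => i _; exact: scaling_gt0.
  by split => // x; rewrite det_colsub_flow cE normrM gtr0_norm.
have usc s x : a < x < b -> psi s x < 1 -> \forall y \near x, psi s y < 1.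
  move=> xab px.
  have H (phi : {ffun 'I_(tag s) -> 'I_n.+2}) : \forall y \near x,
      `|\det (colsub phi (lat_mx R s *m flow_mx F tau T y))| < 1.
    have [P [c0 [c [P0 PE]]]] := detaff s phi.
    have := le_lt_trans (minor_norm_ge _ phi) px; rewrite PE => px1.
    have cv : P * `|affine_comb F c0 c y| @[y --> x] --> P * `|affine_comb F c0 c x|.
      apply: cvgM; [exact: cvg_cst|apply: cvg_norm].
      exact: affine_comb_continuous ch xab.
    by apply: filterS (cvgr_lt _ cv _ px1) => y; rewrite PE.
  by apply: filterS (filter_forall _ H) => y py; exact: bigmax_lt.
have good s u' v' z0 : a < u' -> u' < v' -> v' < b -> u' <= z0 <= v' ->
    1 <= psi s z0 ->
    small [set z | u' <= z <= v' /\ psi s z < delta] (eta * (v' - u')).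
  move=> au' uv' vb' z0uv p1.
  (* One minor attaining the maximum at [z0] suffices: wherever the maximum is below [delta], so is
     this minor. *)
  have [phi phiE] := minor_norm_attained (lt_le_trans ltr01 p1).
  have [P [c0 [c [P0 PE]]]] := detaff s phi.
  have g0 : 1 <= P * `|affine_comb F c0 c z0| by rewrite -PE -phiE.
  have g0' : 0 < `|affine_comb F c0 c z0|.
    by rewrite -(pmulr_rgt0 _ P0); lra.
  apply: small_sub (Fgood c0 c u' v' z0 au' uv' vb' z0uv g0') => //.
  move=> z [zuv pz]; split => //.
  have := le_lt_trans (minor_norm_ge _ phi) pz; rewrite PE => Pz.
  rewrite -(ltr_pM2l P0); apply: (lt_le_trans Pz).
  by rewrite mulrCA ler_peMr// ltW.
have dh x : 1 <= `|\det (flow_mx F tau T x)| by rewrite det_flow_mx// normr1.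
have flagg S z : a < z < b -> flag (@primitive R n.+2) (fun s => tag s) (@lat_cmp R n.+2) n.+1 S ->
   {in S, forall s, delta <= psi s z <= 1} ->
   (forall s, extends_flag (@primitive R n.+2) (fun s => tag s) (@lat_cmp R n.+2) n.+1 S s -> 1 <= psi s z) ->
   ~ [set x | exists2 p : 'rV[int]_n.+2, p != 0 &
     forall j, `|(p%:r *m flow_mx F tau T x) ord0 j| < delta / n.+2%:R] z.
  move=> zab fS Sz ext [p p0 pz].
  have [|j] := flag_short_vector (dh z) _ fS Sz ext p0; first by rewrite d0.
  by rewrite leNgt pz.
have := nondivergence (ltW eta0) (@lat_cmp_refl R n.+2) (@lat_cmp_sym R n.+2)
  usc good flagg (r := n.+1) (S := [::]) _ _ au uv vb.
move=> /(_ _ _ _)H; apply: small_sub (H _ _ _).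
- by move=> x [xuv px]; split => //; split.
- rewrite loss_linear mulrC ler_pM2l ?subr_gt0//.
  by rewrite -/lo /eta ler_pdivrMl; lra.
- by split.
- by [].
- by move=> s [ps /= sn _]; exact: Fhigh.
Qed.

End CurveNondivergence.

(** * Inhomogeneous approximation on a curve *)

Section InhomogeneousApproximation.
Variables (R : realType) (n : nat).
Implicit Types (F : 'I_n.+1 -> nat -> R -> R) (tau T : 'I_n.+1 -> R).
Local Notation "M '%:r'" := (map_mx intr M : 'M[R]_(_, _)) (at level 2, format "M %:r").

Lemma flow_mx_col F tau T x (d : 'rV[R]_n.+2) : tau ord0 = 0 ->
  (flow_mx F tau T x *m d^T) ord0 ord0 = (\prod_i T i) * d ord0 ord0 /\
  forall i, (flow_mx F tau T x *m d^T) (lift ord0 i) ord0 =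
    F i 0 x * ((\prod_i T i) * d ord0 ord0) + d ord0 (lift ord0 i) / T i +
    tau i * (d ord0 (lift ord0 ord0) / T ord0).
Proof.
move=> t0; pose y : 'cV[R]_n.+2 := diag_mx (scaling T) *m d^T.
have yE j : y j ord0 = scaling T ord0 j * d ord0 j.
  by rewrite /y mul_diag_mx !mxE.
have y0 : y ord0 ord0 = (\prod_i T i) * d ord0 ord0.
  by rewrite yE mxE unlift_none.
have yS i : y (lift ord0 i) ord0 = d ord0 (lift ord0 i) / T i.
  by rewrite yE mxE liftK mulrC.
rewrite /flow_mx -mulmxA -/y; split => [|i].
  rewrite mxE big_ord_recl mxE unlift_none y0 mul1r [X in _ + X]big1 ?addr0// => j _.
  by rewrite mxE unlift_none liftK mul0r.
rewrite mxE big_ord_recl mxE unlift_none liftK y0 -addrA; congr (_ + _).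
rewrite (eq_bigr (fun j => (i == j)%:R * y (lift ord0 j) ord0 +
    (j == ord0)%:R * (tau i * y (lift ord0 j) ord0))) => [|j _]; last first.
  by rewrite mxE !liftK; ring.
have delta_sum (G : 'I_n.+1 -> R) k : \sum_j (k == j)%:R * G j = G k.
  rewrite (bigD1 k)//= eqxx mul1r [X in _ + X]big1 ?addr0// => j.
  by rewrite eq_sym => /negPf ->; rewrite mul0r.
rewrite big_split /= delta_sum.
under [X in _ + X]eq_bigr do rewrite eq_sym.
rewrite (delta_sum (fun j => tau i * y (lift ord0 j) ord0)).
by rewrite !yS.
Qed.

(** [covering] solves the congruences by a vector [d] of length at most [r]; its coordinates divided
    by the [T i] are, up to sign, the quantities A_i - tau_i A_0. *)
Lemma inhomogeneous_approximation F tau T x eps theta :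
  tau ord0 = 0 -> (forall i, 0 < T i) -> 0 < eps ->
  (forall p : 'rV[int]_n.+2, p != 0 ->
     exists j, eps <= `|(p%:r *m flow_mx F tau T x) ord0 j|) ->
  let r := 2 ^+ n.+2 / eps in let H := \prod_i T i in
  exists (q : int) (p : 'I_n.+1 -> int), r * H <= q%:~R <= 3 * r * H /\
    forall i, `|(q%:~R * F i 0 x - theta i - (p i)%:~R) -
      tau i * (q%:~R * F ord0 0 x - theta ord0 - (p ord0)%:~R)| <= r / T i.
Proof.
move=> t0 Tpos eps0 hyp r H.
have H0 : 0 < H by apply: prodr_gt0.
have r0 : 0 < r by rewrite divr_gt0// exprn_gt0.
have e0 : 0 < eps * eps by rewrite mulr_gt0.
have hyp' (v : 'rV[int]_n.+2) : v != 0 ->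
    eps * eps <= dot (v%:r *m flow_mx F tau T x) (v%:r *m flow_mx F tau T x).
  move=> /hyp[j jeps]; rewrite dotE (bigD1 j)//=.
  apply: (@le_trans _ _ (`|(v%:r *m flow_mx F tau T x) ord0 j| ^+ 2)).
    by rewrite expr2; apply: ler_pM => //; exact: ltW.
  rewrite real_normK ?num_real// expr2 lerDl sumr_ge0// => i _.
  by rewrite -expr2 sqr_ge0.
(* The shift by 2 r H in the first target, compensated in the others, places [q] between r H and 3 r
   H, because the first coordinate of [d] is at most [r] in absolute value. *)
pose beta : 'cV[R]_n.+2 := \col_i
  if unlift ord0 i is Some i' then theta i' - 2 * r * H * F i' 0 x else - (2 * r * H).
have [d [[z hz] dd]] := covering e0 hyp' beta.
have dr j : `|d ord0 j| <= r.
  rewrite -(ler_pXn2r (_ : 0 < 2)%N) ?nnegrE ?(ltW r0)// real_normK ?num_real//.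
  have : d ord0 j ^+ 2 <= dot d d.
    rewrite dotE (bigD1 j)//= -expr2 lerDl sumr_ge0// => i _.
    by rewrite -expr2 sqr_ge0.
  move=> /le_trans; apply; apply: (le_trans dd).
  have -> : r ^+ 2 = 2 ^+ n.+2 * 2 ^+ n.+2 / (eps * eps).
    by rewrite /r; field; rewrite gt_eqF.
  rewrite ler_pM2r ?invr_gt0//.
  have : 1 <= (2 : R) ^+ n.+2 by rewrite exprn_ege1// ler1n.
  move: (2 ^+ _) => a a1; nra.
have [e1 eS] := flow_mx_col F T x d t0.
rewrite hz in e1 eS.
have q0 : (z ord0 ord0)%:~R = H * (d ord0 ord0 + 2 * r).
  move: e1; rewrite !mxE unlift_none -/H => e1; lra.
exists (z ord0 ord0), (fun i => z (lift ord0 i) ord0); split.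
  have := dr ord0; rewrite ler_norml => /andP[d1 d2]; rewrite q0; nra.
have pE i : (z ord0 ord0)%:~R * F i 0 x - theta i - (z (lift ord0 i) ord0)%:~R =
    - (d ord0 (lift ord0 i) / T i + tau i * (d ord0 (lift ord0 ord0) / T ord0)).
  have := eS i; rewrite !mxE liftK -/H q0 => e; lra.
move=> i; rewrite pE pE t0 mul0r addr0 mulrN opprK opprD addrNK normrN normrM.
rewrite (gtr0_norm (_ : 0 < (T i)^-1)) ?invr_gt0//.
by rewrite ler_pM2r ?invr_gt0.
Qed.

End InhomogeneousApproximation.

Section ApproximationAlongTangent.
Variable R : realType.

Local Ltac nonneg := repeat first [done | exact: ltW | apply: mulr_ge0 | apply: addr_ge0].

Lemma root_near (f df : R -> R) (u v x m d : R) :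
  (forall x, u <= x <= v -> is_derive x 1 f (df x)) ->
  (forall x, u <= x <= v -> m <= df x) \/ (forall x, u <= x <= v -> df x <= - m) ->
  0 < d -> u <= x - d -> x + d <= v -> `|f x| <= m * d ->
  exists2 x', `|x' - x| <= d & f x' = 0.
Proof.
move=> fd sgn d0 ux xv; rewrite ler_norml => /andP[f1 f2].
have d1 y : x - d <= y <= x -> is_derive y 1 f (df y) by move=> ?; apply: fd; lra.
have d2 y : x <= y <= x + d -> is_derive y 1 f (df y) by move=> ?; apply: fd; lra.
have [|c1 cI1 e1] := mvt_norm _ d1; first lra.
have [|c2 cI2 e2] := mvt_norm _ d2; first lra.
have dc y : `|y - x| <= d -> u <= y <= v by rewrite ler_norml; lra.
have [|||x' x'I fx'] := @IVT R f (x - d) (x + d) 0.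
- lra.
- apply: derivable_within_continuous => y; rewrite in_itv/= => yI.
  by have [|] := fd y; first lra.
- case: sgn => sgn.
    have := sgn c1 ltac:(lra); have := sgn c2 ltac:(lra) => h1 h2.
    rewrite ge_min le_max; apply/andP; split; apply/orP; [left|right]; nra.
  have := sgn c1 ltac:(lra); have := sgn c2 ltac:(lra) => h1 h2.
  rewrite ge_min le_max; apply/andP; split; apply/orP; [right|left]; nra.
exists x' => //; move: x'I; rewrite in_itv/= ler_norml; lra.
Qed.

(* A_i = q F_i - t_i; the combinations A_i - tau_i A_0 hardly vary along the
   curve, so moving to the zero of A_0 makes all A_i small at once. *)
Lemma good_interval n (F : 'I_n.+1 -> nat -> R -> R) (t tau s e : 'I_n.+1 -> R)
    (u v x1 K q H C0 c1 c2 L m : R) :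
  (forall i x, u <= x <= v -> is_derive x 1 (F i 0) (F i 1%N x)) ->
  (forall i x, u <= x <= v -> `|F i 1%N x| <= K) ->
  (forall x, u <= x <= v -> m <= F ord0 1%N x) \/
  (forall x, u <= x <= v -> F ord0 1%N x <= - m) ->
  (forall i x, i != ord0 -> u <= x <= v ->
     `|F i 1%N x - tau i * F ord0 1%N x| <= s i) ->
  0 < H -> 0 < C0 -> 0 < c1 -> 0 < c2 -> 0 < L -> 0 < m -> 0 <= K ->
  C0 * H <= q <= 3 * C0 * H ->
  (forall i, 0 < e i) -> (forall i, e ord0 <= e i) ->
  let A i x := q * F i 0 x - t i in
  `|A ord0 x1| <= C0 * L * m * e ord0 ->
  (forall i, i != ord0 -> `|A i x1 - tau i * A ord0 x1| <= c1 / 4 * e i) ->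
  (forall i, i != ord0 -> 3 * C0 * s i * (L + c2) * e ord0 <= c1 / 4 * e i) ->
  (forall i, 3 * C0 * K * c2 * (1 + `|tau i|) <= c1 / 4) ->
  u <= x1 - (L + c2) * (e ord0 / H) -> x1 + (L + c2) * (e ord0 / H) <= v ->
  exists2 x', `|x' - x1| <= L * (e ord0 / H) &
    forall x, `|x - x'| <= c2 * (e ord0 / H) -> forall i, `|A i x| < c1 * e i.
Proof.
move=> dF FK sgn Fs H0 C00 c10 c20 L0 m0 K0 /andP[q1 q2] e0 emin A A1 Ai hs hK ux xv.
set y := e ord0 / H in ux xv *.
have y0 : 0 < y by rewrite divr_gt0.
have Hy : H * y = e ord0 by rewrite /y mulrC divfK// gt_eqF.
have q0 : 0 < q by apply: lt_le_trans q1; rewrite mulr_gt0.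
have qy : q * y <= 3 * C0 * e ord0 by rewrite -Hy; nra.
have Ly : 0 < L * y by rewrite mulr_gt0.
have cy : 0 < c2 * y by rewrite mulr_gt0.
have dA i x : u <= x <= v -> is_derive x 1 (A i) (q * F i 1%N x).
  move=> xuv; have d := dF i x xuv.
  rewrite -[X in is_derive _ _ _ X]subr0.
  rewrite (_ : A i = (fun x => q * F i 0 x) - cst (t i)) //.
  exact: is_deriveB.
have [|||||x' x'x1 Ax'] := @root_near (A ord0) (fun x => q * F ord0 1%N x)
    u v x1 (q * m) (L * y) (dA ord0).
- case: sgn => sgn; [left|right] => x xuv; have := sgn x xuv; nra.
- by [].
- rewrite mulrDl in ux; lra.
- rewrite mulrDl in xv; lra.
- apply: (le_trans A1); rewrite -Hy.
  have : C0 * H * (m * (L * y)) <= q * (m * (L * y)) by apply: ler_wpM2r => //; nonneg.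
  lra.
exists x' => // x xx' i.
have x'uv : u <= x' <= v.
  by move: x'x1; rewrite ler_norml; rewrite mulrDl in ux xv; lra.
have xuv : u <= x <= v.
  by move: x'x1 xx'; rewrite !ler_norml; rewrite mulrDl in ux xv; lra.
have x1uv : u <= x1 <= v by rewrite mulrDl in ux xv; lra.
have A0x : `|A ord0 x| <= 3 * C0 * K * c2 * e ord0.
  have dK z : u <= z <= v -> `|q * F ord0 1%N z| <= q * K.
    by move=> zuv; rewrite normrM gtr0_norm// ler_pM2l// FK.
  have := lipschitz_itv (dA ord0) dK x'uv xuv; rewrite Ax' subr0.
  move=> /le_trans; apply.
  apply: (@le_trans _ _ (q * K * (c2 * y))).
    by apply: ler_wpM2l => //; nonneg.
  have : K * c2 * (q * y) <= K * c2 * (3 * C0 * e ord0).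
    by apply: ler_wpM2l => //; nonneg.
  lra.
have hK1 : 3 * C0 * K * c2 <= c1 / 4.
  apply: le_trans (hK i); rewrite ler_peMr ?lerDl//; nonneg.
have [->|i0] := eqVneq i ord0.
  apply: (le_lt_trans A0x).
  have := e0 ord0; nra.
pose phi z := A i z - tau i * A ord0 z.
have dphi z : u <= z <= v -> is_derive z 1 phi (q * (F i 1%N z - tau i * F ord0 1%N z)).
  move=> zuv; have d1 := dA i z zuv; have d2 := dA ord0 z zuv.
  rewrite (_ : q * _ = q * F i 1%N z - tau i * (q * F ord0 1%N z)); last by ring.
  rewrite (_ : phi = A i - (fun z => tau i * A ord0 z)) //.
  apply: is_deriveB; exact: is_deriveZ.
have ds z : u <= z <= v -> `|q * (F i 1%N z - tau i * F ord0 1%N z)| <= q * s i.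
  by move=> zuv; rewrite normrM gtr0_norm// ler_pM2l// Fs.
have si0 : 0 <= s i by apply: le_trans (Fs i x i0 xuv).
have xx1 : `|x - x1| <= (L + c2) * y.
  by move: x'x1 xx'; rewrite !ler_norml mulrDl; lra.
have p1 : `|phi x| <= c1 / 4 * e i + c1 / 4 * e i.
  rewrite -(subrK (phi x1) (phi x)); apply: (le_trans (ler_normD _ _)); rewrite addrC.
  apply: lerD; first exact: Ai.
  apply: (le_trans (lipschitz_itv dphi ds x1uv xuv)).
  apply: le_trans (hs i i0).
  apply: (@le_trans _ _ (q * s i * ((L + c2) * y))).
    by apply: ler_wpM2l => //; nonneg.
  have : s i * (L + c2) * (q * y) <= s i * (L + c2) * (3 * C0 * e ord0).
    by apply: ler_wpM2l => //; nonneg.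
  lra.
have p2 : `|tau i * A ord0 x| <= c1 / 4 * e i.
  rewrite normrM; apply: (@le_trans _ _ (`|tau i| * (3 * C0 * K * c2 * e ord0))).
    by rewrite ler_wpM2l.
  have B0 : 0 <= 3 * C0 * K * c2 by nonneg.
  have := hK i; have := emin i; have := e0 ord0; have := normr_ge0 (tau i).
  move: (3 * C0 * K * c2) B0 (`|tau i|) (e ord0) (e i) => B B0 ta e1 e2 ta0 e10 e12 hB.
  have : B * ta * e1 <= c1 / 4 * e1 by apply: ler_wpM2r; [exact: ltW|lra].
  nra.
(* Three contributions of at most c1/4 e_i each: the value of [phi] at [x1], its variation, and
   tau_i A_0. *)
have : `|A i x| <= `|phi x| + `|tau i * A ord0 x|.
  by rewrite -{1}(subrK (tau i * A ord0 x) (A i x)); exact: ler_normD.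
have := e0 i; nra.
Qed.

End ApproximationAlongTangent.

(** * The local theorem *)

Section Density.
Variable R : realType.
Implicit Types (E : set R) (x r : R).
Local Notation mu := (@lebesgue_measure R).

Lemma small_negligible E : (forall t, 0 < t -> small E t) -> mu.-negligible E.
Proof.
move=> Es.
have /choice[A AP] : forall j : nat, exists A : set R,
    [/\ measurable A, E `<=` A & (mu A <= (j.+1%:R^-1)%:E)%E].
  by move=> j; apply: Es; rewrite invr_gt0.
have mA : measurable (\bigcap_j A j).
  by apply: bigcapT_measurable => j; have [] := AP j.
exists (\bigcap_j A j); split => //; last first.
  by move=> y Ey j _; have [_ + _] := AP j; apply.
apply/eqP; rewrite eq_le measure_ge0 andbT; apply/lee_addgt0Pr => e e0.
rewrite add0e.
have [j je] : exists j : nat, j.+1%:R^-1 < e.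
  exists (Num.bound e^-1); rewrite invf_plt ?posrE//.
  have /archi_boundP/lt_le_trans : 0 <= e^-1 by rewrite invr_ge0 ltW.
  by apply; rewrite ler_nat.
have [mAj _ Aj] := AP j.
apply: (@le_trans _ _ (mu (A j))).
  by apply: (@le_measure _ _ _ mu); rewrite ?inE//; apply: bigcap_inf.
by apply: (le_trans Aj); rewrite lee_fin ltW.
Qed.

Definition density_point E x := forall lam, lam < 1 -> exists2 r0, 0 < r0 &
  forall r, 0 < r < r0 -> ((lam * (2 * r))%:E < mu (E `&` ball x r))%E.

Lemma negligible_not_density_point E : measurable E ->
  mu.-negligible (E `&` ~` density_point E).
Proof.
move=> mE; have := lebesgue_density mE; apply: negligibleS => x [Ex nd] /= cv.
apply: nd => lam lam1; move: cv; rewrite indicE mem_set// => cv.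
have /cv : nbhs (1%:E : \bar R) [set y | (lam%:E < y)%E].
  by apply: open_nbhs_nbhs; split; [exact: open_ereal_gt_ereal|rewrite /= lte_fin].
move=> [e /= e0 He]; exists e => // r /andP[r0 re].
have /= := He r; rewrite sub0r normrN gtr0_norm// => /(_ re r0).
have r2 : 0 < r *+ 2 by rewrite mulrn_wgt0.
rewrite lebesgue_measure_ball ?ltW// inver gt_eqF// lte_pdivlMr//.
by rewrite mulr_natl.
Qed.

Lemma hole_measure E x x' r d : measurable E -> 0 < d -> `|x' - x| + d <= r ->
  (forall y, `|y - x'| < d -> ~ E y) ->
  (mu (E `&` ball x r) <= (2 * r - 2 * d)%:E)%E.
Proof.
move=> mE d0 xr nE.
have r0 : 0 < r by have := normr_ge0 (x' - x); lra.
have mB (z s : R) : measurable (ball z s) by exact: measurable_ball.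
have mI : measurable (E `&` ball x r) by exact: measurableI.
have dis : (E `&` ball x r) `&` ball x' d = set0.
  apply/seteqP; split => // y [[Ey _]]; rewrite /ball /= distrC => yd.
  by have := nE y yd.
have : (mu ((E `&` ball x r) `|` ball x' d) <= mu (ball x r))%E.
  apply: (@le_measure _ _ _ mu); rewrite ?inE.
  - exact: (measurableU _ _ mI (mB _ _)).
  - exact: mB.
 
  move=> y [[]//|]; rewrite /ball /= => yd.
  have -> : x - y = (x - x') + (x' - y) by lra.
  by apply: (le_lt_trans (ler_normD _ _)); rewrite distrC; lra.
have -> : mu ((E `&` ball x r) `|` ball x' d) = (mu (E `&` ball x r) + mu (ball x' d))%E.
  exact: (@measureU _ _ _ mu _ _ mI (mB x' d) dis).
rewrite (lebesgue_measure_ball x (ltW r0)) (lebesgue_measure_ball x' (ltW d0)).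
by rewrite EFinB leeBrDr// !mulr_natl.
Qed.

(** The points lying in [B j] for all large [j] form an increasing union of sets of measure at most
    [r], while [E] occupies more than 3/2 r of the ball. *)
Lemma frequently_outside_small E (B : nat -> set R) x0 r j0 : measurable E ->
  0 < r -> ((3 / 4 * (2 * r))%:E < mu (E `&` ball x0 r))%E ->
  (forall j, (j0 <= j)%N -> small (B j) r) ->
  exists x, [/\ E x, density_point E x, ball x0 r x &
    forall M, exists2 j, (M <= j)%N & ~ B j x].
Proof.
move=> mE r0 Er Bs.
pose EM M := [set x | forall j, (j0 + M <= j)%N -> B j x].
have [A [mA EA Ar]] : small (\bigcup_M EM M) r.
  apply: small_liminf => [M x Hx j jM|M].
    by apply: Hx; apply: leq_trans jM; rewrite leq_add2l.
  by apply: small_sub (Bs (j0 + M)%N (leq_addr _ _)) => // x; apply.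
apply: contrapT => H.
have [B' [mB' B'0 EB']] := negligible_not_density_point mE.
have : (mu (E `&` ball x0 r) <= r%:E)%E.
  apply: (@le_trans _ _ (mu (A `|` B'))).
    apply: (@le_measure _ _ _ mu); rewrite ?inE.
    - exact: (measurableI _ _ mE (measurable_ball _ _)).
    - exact: (measurableU _ _ mA mB').
    - move=> x [Ex xr]; have [/EA|nx] := pselect ((\bigcup_M EM M) x); first by left.
      right; apply: EB'; split => // dx; apply: H; exists x; split => // M.
      apply: contrapT => nj; apply: nx; exists M => // j jM.
      apply: contrapT => nB; apply: nj; exists j => //.
      by apply: leq_trans jM; exact: leq_addl.
  apply: (@le_trans _ _ (mu A + mu B')%E); first exact: measureU2.
  have -> : mu B' = 0%E by exact: B'0.
  by rewrite adde0.
by move/(lt_le_trans Er); rewrite lte_fin; lra.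
Qed.

End Density.

Section Powers.
Variable R : realType.

Lemma powR_sum n (H : R) (w : 'I_n -> R) : 0 < H ->
  \prod_i H `^ w i = H `^ (\sum_i w i).
Proof.
move=> H0; elim/big_rec2: _ => [|i x y _ ->]; first by rewrite powRr0.
by rewrite powRD// (gt_eqF H0) implybT.
Qed.

Lemma powR_natural_unbounded (w A : R) : 0 < w ->
  \forall j \near \oo, A <= j.+1%:R `^ w.
Proof.
move=> w0; pose B := Num.max A 1.
have B1 : 1 <= B by rewrite le_max lexx orbT.
exists (Num.bound (B `^ w^-1)) => // j /= jB.
apply: (@le_trans _ _ B); first by rewrite le_max lexx.
have -> : B = (B `^ w^-1) `^ w by rewrite -powRrM mulVf ?gt_eqF// powRr1//; lra.
apply: ge0_ler_powR; rewrite ?nnegrE ?powR_ge0// ?ltW//.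
have /archi_boundP/lt_le_trans := powR_ge0 B w^-1; apply.
by rewrite ler_nat ltnW.
Qed.

(** Turns a bound in terms of [H] into one in terms of [q]; b <= b^w holds because b <= 1 and w <=
    1. *)
Lemma powR_div_ge (a q H w : R) : 0 < a -> 0 < H -> 0 < q -> 0 < w <= 1 -> q <= H ->
  Num.min 1 a * H `^ (- w) <= (a / q) `^ w.
Proof.
move=> a0 H0 q0 /andP[w0 w1] qH; set b := Num.min 1 a.
have b0 : 0 < b by rewrite lt_min ltr01.
have bw : b <= b `^ w.
  have e : b = b `^ w * b `^ (1 - w).
    rewrite -powRD; last by rewrite (gt_eqF b0) implybT.
    by rewrite addrC subrK powRr1// ltW.
  rewrite {1}e ler_piMr ?powR_ge0//.
  have one : 1 `^ (1 - w) = 1 :> R by rewrite powR1.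
  rewrite -[leRHS]one; apply: ge0_ler_powR; rewrite ?subr_ge0//.
  - by rewrite nnegrE ltW.
  - by rewrite nnegrE.
  - by rewrite ge_min lexx.
apply: (@le_trans _ _ ((b / H) `^ w)).
  have Hi : 0 <= H^-1 by rewrite invr_ge0 ltW.
  rewrite (powRM w (ltW b0) Hi) -(powR_inv1 (ltW H0)) -powRrM mulN1r.
  by apply: ler_wpM2r => //; exact: powR_ge0.
apply: (ge0_ler_powR (ltW w0)).
- by rewrite nnegrE divr_ge0// ltW.
- by rewrite nnegrE divr_ge0// ltW.
- apply: ler_pM; [exact: ltW|by rewrite invr_ge0 ltW|by rewrite ge_min lexx orbT|].
  by rewrite lef_pV2 ?posrE.
Qed.

End Powers.

Section LocalTheorem.
Variables (R : realType) (n : nat).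
Local Notation mu := (@lebesgue_measure R).

(** For a coordinate vector the last clause of [chart] gives an order k + 1 at which the derivative
    of [F i0] vanishes nowhere, whereas 2^k separated zeros of [F i0 1] would force a zero of it. *)
Lemma derivative_zeros_negligible l (F : 'I_n.+1 -> nat -> R -> R) a b K kap i0 :
  chart l F a b K kap ->
  mu.-negligible [set x | a < x < b /\ F i0 1%N x = 0].
Proof.
move=> [kap0 K0 dF FK Fk]; apply: small_negligible => t t0.
have [k [/andP[k1 kl] Hk]] := Fk (fun i => (i == i0)%:R).
have {}Hk x : a < x < b -> kap <= `|F i0 k x|.
  move=> xab; have := Hk x xab i0; rewrite eqxx normr1 mulr1.
  rewrite (bigD1 i0)//= eqxx mul1r big1 ?addr0// => i /negPf ->.
  by rewrite mul0r.
case: k k1 kl Hk => [//|k] _ kl Hk.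
pose g := t / (2 ^+ k.+1).
have g0 : 0 < g by rewrite divr_gt0// exprn_gt0.
have [sm|[z [zZ zs]]] := @separated_or_small R [set x | a < x < b /\ F i0 1%N x = 0]
    a g (2 ^ k) (ltW g0) (fun z Zz => ltW (proj1 (andP Zz.1))).
  apply: small_sub sm => //.
  by rewrite natrX mulrA -exprSr /g mulrC divfK// gt_eqF// exprn_gt0.
exfalso.
have zI i : (i < 2 ^ k)%N -> z 0%N <= z i <= z (2 ^ k).-1.
  move=> ik; apply/andP; split.
    by case: i ik => [//|i] ik; have := zs 0%N i.+1 ltac:(lia); lra.
  have [->//|ik'] := eqVneq i (2 ^ k).-1.
  by have := zs i (2 ^ k).-1 ltac:(lia); lra.
have k0 : (0 < 2 ^ k)%N by rewrite expn_gt0.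
have [za _] := zZ 0%N isT; have [zb _] := zZ (2 ^ k).-1 ltac:(lia).
have [|||x xI] := @separated_small_derivative R k (fun j => F i0 j.+1) (z 0%N) (z (2 ^ k).-1)
   g 0 z g0 (lexx 0).
- by move=> j x jk xI; apply: dF; [lra|apply: leq_trans kl; rewrite ltnS].
- by move=> i ik; rewrite zI//; have [_ ->] := zZ i (ltnW ik); rewrite normr0.
- by move=> i j /andP[ij jk]; apply: zs; rewrite ij ltnW.
rewrite mulr0 => F0; have := Hk x ltac:(lra); lra.
Qed.

Variables (l : nat) (F : 'I_n.+1 -> nat -> R -> R) (a b K kap : R).
Variables (w theta : 'I_n.+1 -> R) (c : R) (N : nat).
Hypothesis ch : chart l F a b K kap.
Hypothesis F1cont : forall i x, a < x < b -> {for x, continuous (F i 1%N)}.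
Hypothesis w_gt0 : forall i, 0 < w i.
Hypothesis w_max : forall i, w i <= w ord0.
Hypothesis w_sum : \sum_i w i = 1.
Hypothesis c_gt0 : 0 < c.

Definition far_set : set R := [set x | a < x < b /\
  forall (q : int) (p : 'I_n.+1 -> int), 0 < q -> (N%:R <= q)%R ->
  exists i, (c / q%:~R) `^ w i <= `|q%:~R * F i 0 x - theta i - (p i)%:~R| ].

Lemma is_derive_coordinate i x : a < x < b -> is_derive x 1 (F i 0) (F i 1%N x).
Proof.
move=> xab; have [_ _ dF _ Fk] := ch; have [k [/andP[k1 kl] _]] := Fk (fun=> 0).
by apply: dF => //; exact: leq_trans kl.
Qed.

Lemma derivative_le i x : a < x < b -> `|F i 1%N x| <= K.
Proof.
move=> xab; have [_ _ _ FK Fk] := ch; have [k [/andP[k1 kl] _]] := Fk (fun=> 0).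
by apply: FK => //; exact: leq_trans kl.
Qed.

Lemma w_le1 i : w i <= 1.
Proof.
by rewrite -w_sum (bigD1 i)//= lerDl sumr_ge0// => j _; rewrite ltW.
Qed.

Lemma measurable_far_set : measurable far_set.
Proof.
pose O : set R := [set x | a < x < b /\
  exists (q : int) (p : 'I_n.+1 -> int), [/\ 0 < q, (N%:R <= q)%R &
  forall i, `|q%:~R * F i 0 x - theta i - (p i)%:~R| < (c / q%:~R) `^ w i] ].
have -> : far_set = `]a, b[%classic `\` O.
  apply/seteqP; split => x /=; rewrite in_itv/=.
    move=> [xab far]; split => // -[_ [q [p [q0 Nq H]]]].
    by have [i] := far q p q0 Nq; rewrite leNgt H.
  move=> [xab nO]; split => // q p q0 Nq; apply: contrapT => H; apply: nO.
  split => //; exists q, p; split => // i; rewrite ltNge; apply/negP => ?.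
  by apply: H; exists i.
apply: measurableD => //; apply: open_measurable.
rewrite openE => x [xab [q [p [q0 Nq H]]]]; rewrite /interior.
have H' (i : 'I_n.+1) : \forall y \near x,
    `|q%:~R * F i 0 y - theta i - (p i)%:~R| < (c / q%:~R) `^ w i.
  have cF : F i 0 y @[y --> x] --> F i 0 x.
    have [d _] := is_derive_coordinate i xab.
    exact/differentiable_continuous/derivable1_diffP.
  have cv : `|q%:~R * F i 0 y - theta i - (p i)%:~R| @[y --> x] -->
      `|q%:~R * F i 0 x - theta i - (p i)%:~R|.
    apply: cvg_norm; apply: cvgB; last exact: cvg_cst.
    by apply: cvgB; [apply: cvgM => //; exact: cvg_cst|exact: cvg_cst].
  exact: (cvgr_lt _ cv).
have near_ab : \forall y \near x, a < y < b.
  have : x \in `]a, b[%R by rewrite in_itv.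
  by move/near_in_itvoo; apply: filterS => y; rewrite in_itv.
apply: filterS2 near_ab (filter_forall _ H') => y yab Hy.
by split => //; exists q, p.
Qed.

(** The product of the [T i] is [H], so q lies between C0 H and 3 C0 H. [D] makes C0 / T i equal to
    c1/4 H^(-w i) for nonzero i, [L] makes C0 / T 0 equal to C0 L m H^(-w 0), and [c1] is at most c
    / (3 C0) so that c1 H^(-w i) <= (c/q)^(w i). *)
Lemma far_set_hole (eps m c2 H u v x1 : R) (tau s : 'I_n.+1 -> R) :
  let C0 := 2 ^+ n.+2 / eps in
  let c1 := Num.min 1 (c / (3 * C0)) in
  let D := 4 * C0 / c1 in
  let L := D ^+ n / m in
  let T i := if i == ord0 then H `^ w ord0 / D ^+ n else D * H `^ w i in
  let y := H `^ (- w ord0) / H in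
  0 < eps -> 0 < m -> 0 < c2 -> 1 <= H -> a < u -> v < b ->
  N%:R <= C0 * H -> tau ord0 = 0 ->
  (forall x, u <= x <= v -> m <= F ord0 1%N x) \/
  (forall x, u <= x <= v -> F ord0 1%N x <= - m) ->
  (forall i x, i != ord0 -> u <= x <= v ->
     `|F i 1%N x - tau i * F ord0 1%N x| <= s i) ->
  (forall i, i != ord0 ->
     3 * C0 * s i * (L + c2) * H `^ (- w ord0) <= c1 / 4 * H `^ (- w i)) ->
  (forall i, 3 * C0 * K * c2 * (1 + `|tau i|) <= c1 / 4) ->
  u <= x1 - (L + c2) * y -> x1 + (L + c2) * y <= v ->
  (forall p : 'rV[int]_n.+2, p != 0 ->
     exists j, eps <= `|(map_mx intr p *m flow_mx F tau T x1) ord0 j|) ->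
  exists2 x', `|x' - x1| <= L * y &
    forall x, `|x - x'| < c2 * y -> ~ far_set x.
Proof.
move=> C0 c1 D L T y eps0 m0 c20 H1 au vb NH t0 sgn Fs hs hK ux xv hyp.
have [_ K0 _ _ _] := ch.
have H0 : 0 < H by lra.
have C00 : 0 < C0 by rewrite divr_gt0// exprn_gt0.
have c10 : 0 < c1 by rewrite lt_min ltr01/= divr_gt0// mulr_gt0.
have D0 : 0 < D by rewrite divr_gt0// mulr_gt0.
have Dn0 : 0 < D ^+ n by rewrite exprn_gt0.
have L0 : 0 < L by rewrite divr_gt0.
have Hw (r : R) : 0 < H `^ r by rewrite powR_gt0.
have T0 i : 0 < T i by rewrite /T; case: ifP => _; [exact: divr_gt0|exact: mulr_gt0].
have TH : \prod_i T i = H.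
  have <- : \prod_i H `^ w i = H by rewrite powR_sum// w_sum powRr1// ltW.
  rewrite !big_ord_recl {1}/T eqxx.
  rewrite (eq_bigr (fun i => D * H `^ w (lift ord0 i))) => [|i _]; last first.
    by rewrite /T eq_sym eq_liftF.
  rewrite big_split /= prodr_const card_ord mulrA divfK// gt_eqF//.
have [q [p [qH pq]]] := inhomogeneous_approximation theta t0 T0 eps0 hyp.
rewrite TH -/C0 in qH pq.
pose e i := H `^ (- w i).
have eV i : (H `^ w i)^-1 = e i by rewrite -powRN.
have qH0 : C0 * H <= q%:~R :> R by case/andP: qH.
have q0 : 0 < q%:~R :> R by apply: lt_le_trans qH0; rewrite mulr_gt0.
have Fab x : u <= x <= v -> a < x < b by move=> ?; lra.
have emin i : e ord0 <= e i.
  rewrite /e !powRN lef_pV2 ?posrE//.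
  by apply: ler_powR.
have qH' : C0 * H <= (q%:~R : R) <= 3 * C0 * H by [].
have [||x' x'x1 Hx'] := good_interval (fun i x xuv => is_derive_coordinate i (Fab x xuv))
   (fun i x xuv => derivative_le i (Fab x xuv)) sgn Fs H0 C00 c10 c20 L0 m0 K0 qH'
   (fun i => Hw (- w i)) emin (t := fun i => theta i + (p i)%:~R)
   (x1 := x1) _ _ hs hK ux xv.
- have := pq ord0; rewrite t0 mul0r subr0 opprD addrA => /le_trans; apply.
  rewrite /T eqxx -/(e ord0) le_eqVlt; apply/orP; left; apply/eqP.
  by rewrite /L -eV; field; rewrite ?gt_eqF//=.
- move=> i i0; have := pq i; rewrite !opprD !addrA => /le_trans; apply.
  rewrite /T (negPf i0) -/(e i) -eV le_eqVlt; apply/orP; left; apply/eqP.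
  by rewrite /D; field; rewrite ?gt_eqF//=.
exists x' => // x xx' [xab /(_ q p)].
case.
- by rewrite -(ltr0z R).
- by rewrite -(ler_int R) rmorph_nat; apply: le_trans qH0.
move=> i; apply/negP; rewrite -ltNge.
have := Hx' x (ltW xx') i; rewrite opprD addrA => /lt_le_trans; apply.
have -> : c / q%:~R = (c / (3 * C0)) / (q%:~R / (3 * C0)).
  by field; rewrite ?gt_eqF//=.
apply: powR_div_ge => //.
- by rewrite divr_gt0// mulr_gt0.
- by rewrite divr_gt0// mulr_gt0.
- by rewrite w_gt0 w_le1.
- by rewrite ler_pdivrMr; [case/andP: qH => _; lra|rewrite mulr_gt0].
Qed.

Lemma far_set_negligible : mu.-negligible far_set.
Proof.
have q34 : 3 / 4 < 1 :> R by lra.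
have half_lt (z : R) : 0 < z -> z / 2 < z by lra.
have [kap0 K0 _ _ _] := ch.
apply: contrapT => nnE; have mE := measurable_far_set.
have Zn := derivative_zeros_negligible ord0 ch.
have Dn := negligible_not_density_point mE.
have [x0 [E0 dens0 F0]] : exists x0, [/\ far_set x0, density_point far_set x0 &
    F ord0 1%N x0 != 0].
  apply: contrapT => H; apply: nnE; apply: negligibleS (negligibleU Zn Dn) => x Ex.
  have [F0|F0] := eqVneq (F ord0 1%N x) 0; first by left; split => //; exact: Ex.1.
  by right; split => // dx; apply: H; exists x.
have x0ab : a < x0 < b by exact: E0.1.
have [eps eps0 Hnd] := curve_nondivergence ch.
pose C0 := 2 ^+ n.+2 / eps.
have C00 : 0 < C0 by rewrite divr_gt0// exprn_gt0.
pose c1 := Num.min 1 (c / (3 * C0)).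
have c10 : 0 < c1 by rewrite lt_min ltr01/= divr_gt0// mulr_gt0.
pose D := 4 * C0 / c1.
have D0 : 0 < D by rewrite divr_gt0// mulr_gt0.
have Dn0 : 0 < D ^+ n by rewrite exprn_gt0.
pose m := `|F ord0 1%N x0| / 2.
have m0 : 0 < m by rewrite divr_gt0// normr_gt0.
pose L := D ^+ n / m.
have L0 : 0 < L by rewrite divr_gt0.
pose tau i := if (i != ord0) && (w i == w ord0) then F i 1%N x0 / F ord0 1%N x0 else 0.
have t0 : tau ord0 = 0 by rewrite /tau eqxx.
pose tm := \sum_i `|tau i|.
have tm0 : 0 <= tm by rewrite sumr_ge0.
have tmi i : `|tau i| <= tm by rewrite /tm (bigD1 i)//= lerDl sumr_ge0.
(* [tm] dominates every |tau i|, so A_0 stays small enough on the hole even after multiplication by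
   any [tau i]. *)
pose c2 := c1 / (12 * C0 * (K + 1) * (1 + tm)).
have K10 : 0 < K + 1 by rewrite ltr_wpDl.
have tm10 : 0 < 1 + tm by rewrite ltr_pwDl.
have Q0 : 0 < 12 * C0 * (K + 1) * (1 + tm).
  by apply: mulr_gt0 => //; apply: mulr_gt0 => //; exact: mulr_gt0.
have c20 : 0 < c2 by rewrite divr_gt0.
have hK i : 3 * C0 * K * c2 * (1 + `|tau i|) <= c1 / 4.
  have -> : c1 / 4 = 3 * C0 * (K + 1) * c2 * (1 + tm).
    by rewrite /c2; field; rewrite (gt_eqF K10) (gt_eqF tm10) (gt_eqF C00).
  have C0n := ltW C00; have c2n := ltW c20.
  apply: ler_pM; [by do !apply: mulr_ge0 => //|by rewrite addr_ge0| |by rewrite lerD2l].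
  by apply: ler_wpM2r => //; apply: ler_wpM2l; [exact: mulr_ge0|rewrite lerDl].
have Lc0 : 0 < L + c2 by rewrite addr_gt0.
(* [s0] involves [L], hence [eps], and the interval [u, v] is chosen in terms of [s0]: this is where
   [eps] must precede the interval. *)
pose s0 := c1 / (12 * C0 * (L + c2)).
have s00 : 0 < s0 by apply: divr_gt0 => //; do !apply: mulr_gt0 => //.
(* For w i < w 0 the crude bound [K] is enough, since H^(w 0 - w i) tends to infinity. *)
pose s i := if w i == w ord0 then s0 else K.
have cvF i : F i 1%N y @[y --> x0] --> F i 1%N x0 by exact: F1cont.
have cvg i : F i 1%N y - tau i * F ord0 1%N y @[y --> x0] -->
    F i 1%N x0 - tau i * F ord0 1%N x0.
  by apply: cvgB => //; apply: cvgM => //; exact: cvg_cst.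
have n1 (i : 'I_n.+1) : \forall y \near x0, `|F i 1%N x0 - tau i * F ord0 1%N x0 -
    (F i 1%N y - tau i * F ord0 1%N y)| <= s0.
  by move/cvgrPdist_le: (cvg i); apply.
have n2 : \forall y \near x0, `|F ord0 1%N x0 - F ord0 1%N y| <= m.
  by move/cvgrPdist_le: (cvF ord0); apply.
have n3 : \forall y \near x0, a < y < b.
  have : x0 \in `]a, b[%R by rewrite in_itv.
  by move/near_in_itvoo; apply: filterS => y; rewrite in_itv.
have : nbhs x0 ([set y | a < y < b] `&` ([set y | `|F ord0 1%N x0 - F ord0 1%N y| <= m] `&`
    [set y | forall i, `|F i 1%N x0 - tau i * F ord0 1%N x0 -
    (F i 1%N y - tau i * F ord0 1%N y)| <= s0])).
  exact: filterI n3 (filterI n2 (filter_forall _ n1)).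
move=> /nbhs_ballP[e /= e0 He].
have [r0 r00 Hr0] := dens0 (3 / 4) q34.
pose r := Num.min (e / 2) (r0 / 2).
have rr : 0 < r by rewrite lt_min !divr_gt0.
have re : r < e by rewrite gt_min half_lt.
have rr0 : r < r0 by rewrite gt_min half_lt// orbT.
pose u := x0 - r; pose v := x0 + r.
have uvI x : u <= x <= v -> [/\ a < x < b, `|F ord0 1%N x0 - F ord0 1%N x| <= m &
   forall i, `|F i 1%N x0 - tau i * F ord0 1%N x0 -
    (F i 1%N x - tau i * F ord0 1%N x)| <= s0].
  rewrite /u /v => xuv; have [|h1 [h2 h3]] := He x; last by [].
  by rewrite /ball /=; apply: le_lt_trans re; rewrite ler_distlC.
have uv : u < v by rewrite /u /v ltrD2l gtrN.
have au : a < u by have [|/andP[]] := uvI u; first by rewrite lexx ltW.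
have vb : v < b by have [|/andP[]] := uvI v; first by rewrite lexx ltW.
have sgn : (forall x, u <= x <= v -> m <= F ord0 1%N x) \/
  (forall x, u <= x <= v -> F ord0 1%N x <= - m).
  have m2 : `|F ord0 1%N x0| = 2 * m by rewrite /m mulrC divfK.
  have [F0p|F0n] := leP 0 (F ord0 1%N x0); [left|right] => x /uvI[_ + _].
    by rewrite ger0_norm// in m2; rewrite ler_norml; lra.
  by rewrite ltr0_norm// in m2; rewrite ler_norml; lra.
have Fs i x : i != ord0 -> u <= x <= v ->
    `|F i 1%N x - tau i * F ord0 1%N x| <= s i.
  move=> i0 xuv; have [xab _ /(_ i)] := uvI x xuv; rewrite /s /tau i0 /=.
  case: eqP => _; last by move=> _; rewrite mul0r subr0 derivative_le.
  by rewrite divfK// subrr sub0r normrN.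
have [Tmin _ Hsm] := Hnd u v au uv vb.
pose T (j : nat) i := if i == ord0 then j.+1%:R `^ w ord0 / D ^+ n else D * j.+1%:R `^ w i.
have ev1 (i : 'I_n.+1) : \forall j \near \oo, Tmin <= T j i.
  rewrite /T; case: eqP => _.
    by near=> j; rewrite ler_pdivlMr//; near: j; exact: powR_natural_unbounded.
  by near=> j; rewrite mulrC -ler_pdivrMr//; near: j; exact: powR_natural_unbounded.
have ev2 (i : 'I_n.+1) : \forall j \near \oo, i != ord0 ->
    3 * C0 * s i * (L + c2) * j.+1%:R `^ (- w ord0) <= c1 / 4 * j.+1%:R `^ (- w i).
  rewrite /s; have [wi|wi] := eqVneq (w i) (w ord0).
    apply: nearW => j _; rewrite wi; apply: ler_wpM2r; first exact: powR_ge0.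
    rewrite le_eqVlt /s0; apply/orP; left; apply/eqP.
    move: (L + c2) (gt_eqF Lc0) => X X0; field; by rewrite X0 (gt_eqF C00).
  have wi0 : 0 < w ord0 - w i by rewrite subr_gt0 lt_neqAle wi w_max.
  near=> j; move=> _.
  have -> : j.+1%:R `^ (- w i) = j.+1%:R `^ (w ord0 - w i) * j.+1%:R `^ (- w ord0) :> R.
    rewrite -powRD; last by rewrite (gt_eqF (ltr0Sn _ _)) implybT.
    by congr (_ `^ _); ring.
  rewrite [leRHS]mulrA; apply: ler_wpM2r; first exact: powR_ge0.
  have c40 : 0 < c1 / 4 by rewrite divr_gt0.
  rewrite [leRHS]mulrC -ler_pdivrMr//; near: j.
  exact: powR_natural_unbounded.
have ev3 : \forall j \near \oo, N%:R <= C0 * j.+1%:R.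
  near=> j; rewrite mulrC -ler_pdivrMr// -[leRHS]powRr1//; near: j.
  exact: powR_natural_unbounded.
have [j0 _ Hj0] := filterI ev3 (filterI (filter_forall _ ev1) (filter_forall _ ev2)).
pose Bs j := [set x | u <= x <= v /\ exists2 p : 'rV[int]_n.+2, p != 0 &
     forall i, `|(map_mx intr p *m flow_mx F tau (T j) x) ord0 i| < eps].
have Bsm j : (j0 <= j)%N -> small (Bs j) r.
  move=> /Hj0[_ [jT _]]; rewrite (_ : r = (v - u) / 2); last by rewrite /u /v; field.
  exact: Hsm.
have [x1 [E1 dens1 x1r freq]] := frequently_outside_small mE rr (Hr0 r (introT andP (conj rr rr0))) Bsm.
have x1u : u < x1 < v.
  by move: x1r; rewrite /ball /= ltr_distlC.
(* A hole of radius c2 y inside the ball of radius (L + c2) y leaves at most this proportion to the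
   set. *)
have [r1 r10 Hr1] := dens1 (L / (L + c2)) ltac:(by rewrite ltr_pdivrMr// mul1r ltrDl).
pose r2 := Num.min r1 (Num.min (x1 - u) (v - x1)).
have r20 : 0 < r2 by rewrite !lt_min r10 !subr_gt0.
have [j1 _ Hj1] := powR_natural_unbounded ((L + c2) / r2 + 1) ltr01.
have [j jj nBs] := freq (j0 + j1)%N.
have [NH [_ jS]] := Hj0 j (leq_trans (leq_addr _ _) jj).
have := Hj1 j (leq_trans (leq_addl _ _) jj); rewrite powRr1// => r2H.
set H : R := j.+1%:R in NH jS r2H.
have H1 : 1 <= H by rewrite ler1n.
pose y := H `^ (- w ord0) / H.
have y0 : 0 < y by rewrite divr_gt0// ?powR_gt0//; exact: lt_le_trans H1.
have yr : (L + c2) * y < r2.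
  have Hw1 : H `^ (- w ord0) <= 1.
    by rewrite -(powRr0 H); apply: ler_powR => //; rewrite oppr_le0 ltW.
  have : (L + c2) / r2 < H by apply: lt_le_trans r2H; rewrite ltrDl.
  rewrite ltr_pdivrMr// => h; rewrite /y mulrA ltr_pdivrMr; last exact: lt_le_trans H1.
  apply: le_lt_trans (_ : L + c2 < _); last by rewrite mulrC.
  by rewrite ler_piMr// ltW.
move: yr; rewrite !lt_min => /and3P[yr1 yu yv].
have ux : u <= x1 - (L + c2) * y by rewrite lerBrDr -lerBrDl ltW.
have xv : x1 + (L + c2) * y <= v by rewrite -lerBrDl ltW.
have hyp (p : 'rV[int]_n.+2) : p != 0 ->
    exists i, eps <= `|(map_mx intr p *m flow_mx F tau (T j) x1) ord0 i|.
  move=> p0; apply: contrapT => no; apply: nBs; split.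
    by case/andP: x1u => /ltW -> /ltW ->.
  by exists p => // i; rewrite ltNge; apply/negP => ?; apply: no; exists i.
have [x' x'x1 Hx'] := far_set_hole eps0 m0 c20 H1 au vb NH t0 sgn Fs jS hK ux xv hyp.
rewrite -/H -/C0 -/c1 -/D -/L -/y in x'x1 Hx'.
have x'L : `|x' - x1| + c2 * y <= (L + c2) * y by rewrite mulrDl lerD2r.
have := hole_measure mE (mulr_gt0 c20 y0) x'L Hx'.
have Ly : 0 < (L + c2) * y < r1 by rewrite mulr_gt0.
move/(lt_le_trans (Hr1 _ Ly)); rewrite lte_fin.
have -> : L / (L + c2) * (2 * ((L + c2) * y)) = 2 * (L * y).
  by field; rewrite (gt_eqF Lc0).
by rewrite -mulrBr [(L + c2) * y]mulrDl addrK ltxx.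
Unshelve. all: by end_near.
Qed.

End LocalTheorem.

(** * From the local theorem to nondegenerate curves *)

Section Reduction.
Variable R : realType.
Local Notation mu := (@lebesgue_measure R).

Lemma row_free_of_free n (g : 'I_n -> 'rV[R]_n) :
  free [seq g i | i <- enum 'I_n] -> row_free (\matrix_(i, j) g i ord0 j).
Proof.
set s := map _ _ => fs; have ss : size s = n by rewrite size_map size_enum_ord.
have sg (i : 'I_n) : s`_i = g i.
  by rewrite /s (nth_map i) ?size_enum_ord// nth_ord_enum.
apply: inj_row_free => v vg.
pose k (j : nat) : R := if insub j is Some i then v ord0 i else 0.
have kv (i : 'I_n) : k i = v ord0 i by rewrite /k valK.
have /freeP fs' : free (in_tuple s) by [].
have k0 := fs' (fun i => k i).
have sum0 : \sum_(i < size s) k i *: s`_i = 0.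
  rewrite -(big_mkord xpredT (fun j => k j *: s`_j)) ss big_mkord.
  apply/rowP => j; rewrite summxE.
  transitivity ((v *m \matrix_(i, j) g i ord0 j) ord0 j); last by rewrite vg.
  by rewrite [RHS]mxE; apply: eq_bigr => i _; rewrite sg kv [LHS]mxE [in RHS]mxE.
apply/rowP => i; rewrite mxE -kv.
have iss : (i < size s)%N by rewrite ss.
exact: (k0 sum0 (Ordinal iss)).
Qed.

(** The chosen derivatives at [x0] form an invertible matrix [W] whose inverse has row sums at most
    [B], so for each [c] one of the orders gives a combination of size at least max |c i| / B at
    [x0]. Continuity preserves half of this nearby, whence kap = 1 / (2 B). *)
Lemma chart_at n N l (f : R -> 'rV[R]_N) x0 (iota : 'I_n.+1 -> 'I_N) :
  nondegenerate_at l f x0 -> injective iota ->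
  let F i k x := (f^`(k) x) ord0 (iota i) in
  exists a b K kap, [/\ a < x0 < b, chart l F a b K kap &
    forall i x, a < x < b -> {for x, continuous (F i 1%N)}].
Proof.
move=> [fCl [J [Jl Jfree]]] inj F.
have l1 : (1 <= l)%N by have /andP[h1 h2] := Jl (iota ord0); exact: leq_trans h2.
have /nbhs_ballP[e0 /= e00 fe] := fCl.
have dF i k x : ball x0 e0 x -> (k < l)%N -> is_derive x 1 (F i k) (F i k.+1 x).
  move=> /fe[/(_ k) fd _] kl; have {}fd := fd kl.
  have fdi := (derivable_mxP _ _ _).1 fd ord0 (iota i).
  by apply: DeriveDef => //; rewrite /F derive1nS derive1E derive_mx// mxE.
have cF i k x : ball x0 e0 x -> (k <= l)%N -> {for x, continuous (F i k)}.
  move=> xe; rewrite leq_eqVlt => /predU1P[->|kl].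
    have [_ fc] := fe x xe.
    exact: (continuous_comp fc (@coord_continuous _ _ _ ord0 (iota i) _)).
  have [d _] := dF i k x xe kl.
  exact/differentiable_continuous/derivable1_diffP.
pose W : 'M[R]_N := \matrix_(i, j) (f^`(J i) x0) ord0 j.
have uW : W \in unitmx by rewrite -row_free_unit; exact: row_free_of_free.
pose B := 1 + \sum_i \sum_j `|invmx W i j|.
have B1 : 1 <= B by rewrite lerDl sumr_ge0// => i _; exact: sumr_ge0.
have B0 : 0 < B by lra.
have BW i : \sum_j `|invmx W i j| <= B.
  rewrite /B [X in 1 + X](bigD1 i)//= addrCA lerDl.
  by rewrite addr_ge0// sumr_ge0// => ? _; exact: sumr_ge0.
have key (c : 'I_n.+1 -> R) : exists k, (1 <= k <= l)%N /\
    forall i, `|c i| <= B * `|\sum_i c i * F i k x0|.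
  pose C : 'cV[R]_N := \col_j \sum_(i | iota i == j) c i.
  have Ci i : C (iota i) ord0 = c i.
    by rewrite mxE (big_pred1 i)// => i'; rewrite /= (inj_eq inj).
  have WC j : (W *m C) j ord0 = \sum_i c i * F i (J j) x0.
    rewrite mxE; under eq_bigr do rewrite !mxE mulr_sumr.
    rewrite (exchange_big_dep xpredT)//=; apply: eq_bigr => i _.
    by rewrite (big_pred1 (iota i))// mulrC.
  case: (@arg_maxP _ _ _ (iota ord0) xpredT (fun j => `|(W *m C) j ord0|)) => // j _ jmax.
  exists (J j); split => [|i]; first exact: Jl.
  rewrite -WC -(Ci i) -[C in leLHS](mulKmx uW) mxE.
  apply: (le_trans (ler_norm_sum _ _ _)).
  apply: (@le_trans _ _ (\sum_j' `|invmx W (iota i) j'| * `|(W *m C) j ord0|)).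
    by apply: ler_sum => j' _; rewrite normrM ler_wpM2l//; exact: jmax.
  by rewrite -mulr_suml ler_wpM2r.
(* With |c i| <= B S for each of the n + 1 coordinates, errors of size [d] add up to at most S /
   2. *)
pose d := (2 * B * n.+1%:R)^-1.
have d0 : 0 < d by rewrite invr_gt0 mulr_gt0 ?mulr_gt0.
have nearF (i : 'I_n.+1) (k : 'I_l.+1) : \forall x \near x0, `|F i k x0 - F i k x| <= d.
  have := cF i k x0 (ballxx _ e00) (leq_ord k).
  by move/cvgrPdist_le; apply.
have : nbhs x0 [set x | forall (i : 'I_n.+1) (k : 'I_l.+1), `|F i k x0 - F i k x| <= d].
  exact: (filter_forall _ (fun i => filter_forall _ (nearF i))).
move=> /nbhs_ballP[e1 /= e10 He1].
pose e := Num.min e0 e1.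
have e_gt0 : 0 < e by rewrite lt_min e00.
have inE0 x : x0 - e < x < x0 + e -> ball x0 e0 x /\ ball x0 e1 x.
  rewrite /ball /= !ltr_norml.
  have : e <= e0 by rewrite ge_min lexx.
  have : e <= e1 by rewrite ge_min lexx orbT.
  by move=> ? ? ?; split; lra.
pose K := \sum_i \sum_(k < l.+1) (`|F i k x0| + d).
have Fd i k x : x0 - e < x < x0 + e -> (k <= l)%N -> `|F i k x0 - F i k x| <= d.
  move=> /inE0[_ x1] kl; have := He1 x x1 i (Ordinal (kl : (k < l.+1)%N)).
  exact.
have K0 : 0 <= K.
  by apply: sumr_ge0 => i _; apply: sumr_ge0 => k _; rewrite addr_ge0// ltW.
exists (x0 - e), (x0 + e), K, (2 * B)^-1; split.
- lra.
- split => //.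
  + by rewrite invr_gt0 mulr_gt0.
  + by move=> i k x /inE0[xe _]; exact: dF.
  + move=> i k x xe kl.
    have -> : F i k x = F i k x0 - (F i k x0 - F i k x) by ring.
    apply: (le_trans (ler_normB _ _)).
    apply: (@le_trans _ _ (`|F i k x0| + d)); first by rewrite lerD2l Fd.
    rewrite /K (bigD1 i)//= (bigD1 (Ordinal (kl : (k < l.+1)%N)))//= -addrA lerDl.
    rewrite addr_ge0// sumr_ge0// => j _; first by rewrite addr_ge0// ltW.
    by apply: sumr_ge0 => k' _; rewrite addr_ge0// ltW.
  + move=> c; have [k [k1l kc]] := key c; exists k; split => // x xe i.
    set S := `|\sum_i c i * F i k x0| in kc.
    have dS : `|\sum_i c i * F i k x0 - \sum_i c i * F i k x| <= S / 2.
      rewrite -sumrB; apply: (le_trans (ler_norm_sum _ _ _)).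
      apply: (@le_trans _ _ (\sum_(i < n.+1) B * S * d)).
        apply: ler_sum => j _; rewrite -mulrBr normrM; apply: ler_pM => //.
        by apply: Fd => //; case/andP: k1l.
      rewrite sumr_const card_ord -[X in X <= _]mulr_natl le_eqVlt.
      apply/orP; left; apply/eqP; rewrite /d.
      move: (n.+1%:R) (ltr0Sn R n) => nn nn0.
      by field; rewrite (gt_eqF nn0) (gt_eqF B0).
    have SS : S - S / 2 <= `|\sum_i c i * F i k x|.
      have : S <= `|\sum_i c i * F i k x0 - \sum_i c i * F i k x| +
          `|\sum_i c i * F i k x|.
        rewrite /S -{1}(subrK (\sum_i c i * F i k x) (\sum_i c i * F i k x0)).
        exact: ler_normD.
      lra.
    apply: le_trans SS; rewrite ler_pdivrMl ?mulr_gt0//.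
    apply: (le_trans (kc i)); lra.
- by move=> i x /inE0[xe _]; exact: cF.
Qed.

Lemma dist_int_le (y : R) (p : int) : dist_int y <= `|y - p%:~R|.
Proof.
apply: ge_inf; last by exists p.
by exists 0 => _ [m _ <-].
Qed.

Lemma dist_int_ge0 (y : R) : 0 <= dist_int y.
Proof.
apply: lb_le_inf; first by exists `|y - 0%:~R|; exists 0.
by move=> _ [m _ <-].
Qed.

(** One integer gives both the threshold for [q] and the lower bound, so that countably many sets
    cover [Bad]. *)
Lemma Bad_lower_bound N (theta w x : 'rV[R]_N) : Bad theta w x ->
  exists j : nat, forall q : int, 0 < q -> (j%:R <= q)%R ->
    j.+1%:R^-1 <= bad_term theta w x q.
Proof.
rewrite /Bad /= limf_einfE => /ereal_sup_gt[_ [V [M _ MV] <-] Vpos].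
have [c c0 Hc] : exists2 c : R, 0 < c & forall q, V q -> c <= bad_term theta w x q.
  have lb q : V q -> (ereal_inf [set (bad_term theta w x q)%:E | q in V] <=
      (bad_term theta w x q)%:E)%E.
    by move=> Vq; apply: ereal_inf_lbound; exists q.
  move: Vpos lb; case: (ereal_inf _) => [c| |//] c0 lb.
    by rewrite lte_fin in c0; exists c => // q /lb; rewrite lee_fin.
  by exists 1 => // q /lb; rewrite leye_eq.
pose j := maxn M (Num.bound c^-1).
exists j => q q0 jq; apply: (@le_trans _ _ c).
  rewrite invf_ple ?posrE//; apply: ltW.
  have /archi_boundP/lt_le_trans : 0 <= c^-1 by rewrite invr_ge0 ltW.
  by apply; rewrite ler_nat /j leqW// leq_maxr.
apply: Hc; apply: MV; split; first by rewrite gt_eqF.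
have : (M%:R <= q)%R by apply: le_trans jq; rewrite ler_nat leq_maxl.
by rewrite natz; case: q {q0 jq} => // q; rewrite lez_nat.
Qed.

(** A coordinate of weight 0 contributes 0 < c / q, so the coordinate found has positive weight. *)
Lemma bad_term_far N (theta w x : 'rV[R]_N) (q : int) (c : R) : 0 < q -> 0 < c ->
  (forall i, 0 <= w ord0 i) -> c <= bad_term theta w x q ->
  exists i, 0 < w ord0 i /\ forall p : int,
   (c / q%:~R) `^ w ord0 i <= `|q%:~R * x ord0 i - theta ord0 i - p%:~R|.
Proof.
move=> q0 c0 w0; have q0' : 0 < q%:~R :> R by rewrite ltr0z.
have cq0 : 0 < c / q%:~R by rewrite divr_gt0.
rewrite /bad_term gtr0_norm// -ler_pdivrMr// => cb.
have [i ci] : exists i, c / q%:~R <=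
    dist_int_pow (q%:~R * x ord0 i - theta ord0 i) (w ord0 i).
  apply: contrapT => H; move: cb; rewrite leNgt => /negP; apply.
  apply: bigmax_lt => // i _; rewrite ltNge; apply/negP => ?; apply: H; by exists i.
exists i; move: ci; rewrite /dist_int_pow; case: eqVneq => [_|wi].
  by rewrite leNgt cq0.
have wi0 : 0 < w ord0 i by rewrite lt_def wi w0.
set y := _ - _ => cy; split => // p; apply: le_trans (dist_int_le y p).
have -> : dist_int y = (dist_int y `^ (w ord0 i)^-1) `^ w ord0 i.
  by rewrite -powRrM mulVf// powRr1// dist_int_ge0.
apply: (ge0_ler_powR (w0 i)) => //; rewrite nnegrE; [exact: ltW|exact: powR_ge0].
Qed.

(** Drops the coordinates of weight 0 and puts one of largest weight first, as the local theorem
    requires. *)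
Lemma positive_weights N (w : 'rV[R]_N) : is_weight w ->
  exists n (iota : 'I_n.+1 -> 'I_N), [/\ injective iota,
    forall i, 0 < w ord0 (iota i), forall i, w ord0 (iota i) <= w ord0 (iota ord0),
    \sum_i w ord0 (iota i) = 1 & forall j, 0 < w ord0 j -> exists i, iota i = j].
Proof.
move=> [w0 w1].
have [j0 wj0] : exists j, 0 < w ord0 j.
  apply: contrapT => H; move: w1; rewrite big1 => [/eqP|j _]; first by rewrite eq_sym oner_eq0.
  by apply/eqP; rewrite eq_le w0 andbT leNgt; apply/negP => ?; apply: H; exists j.
case: (@arg_maxP _ _ _ j0 xpredT (fun j => w ord0 j)) => // m _ wm.
have wm0 : 0 < w ord0 m by apply: lt_le_trans (wm j0 isT).
pose s := m :: [seq j <- enum 'I_N | (0 < w ord0 j) && (j != m)].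
have us : uniq s by rewrite /= mem_filter eqxx andbF/= filter_uniq// enum_uniq.
have mems j : (j \in s) = (0 < w ord0 j).
  rewrite inE mem_filter mem_enum andbT.
  by have [->|jm] := eqVneq j m; rewrite ?wm0 ?andbT.
exists (size s).-1, (fun i => nth m s i); split.
- move=> i j /eqP; rewrite nth_uniq ?ltn_ord// => /eqP; exact: val_inj.
- by move=> i; rewrite -mems mem_nth ?ltn_ord.
- by move=> i; apply: wm.
- transitivity (\sum_(j <- s) w ord0 j); first by rewrite (big_nth m) big_mkord.
  rewrite -w1 [RHS](bigID (fun j => 0 < w ord0 j)) /= [X in _ = _ + X]big1 ?addr0.
    rewrite [RHS](bigD1 m)//= big_cons; congr (_ + _).
    by rewrite big_filter big_enum_cond.
  by move=> j wj; apply/eqP; rewrite eq_le w0 andbT leNgt.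
- move=> j; rewrite -mems => js.
  have js' : (index j s < (size s).-1.+1)%N by rewrite prednK// index_mem.
  by exists (Ordinal js'); rewrite /= nth_index.
Qed.

Lemma Bad_locally_negligible N l (theta w : 'rV[R]_N) (f : R -> 'rV[R]_N) x0 :
  is_weight w -> nondegenerate_at l f x0 ->
  exists a b, a < x0 < b /\ mu.-negligible [set x | a < x < b /\ Bad theta w (f x)].
Proof.
move=> ww nd; have [n [iota [inj wpos wmax wsum iotaP]]] := positive_weights ww.
have [a [b [K [kap [abx0 ch cF1]]]]] := chart_at nd inj.
exists a, b; split => //.
set F := (fun i k x => _) in ch cF1.
pose E j := far_set F a b (fun i => w ord0 (iota i)) (fun i => theta ord0 (iota i))
  j.+1%:R^-1 j.
have En j : mu.-negligible (E j).
  by apply: far_set_negligible ch cF1 wpos wmax wsum _; rewrite invr_gt0.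
apply: negligibleS (negligible_bigcup En) => x [xab /Bad_lower_bound[j Hj]].
exists j => //; split => // q p q0 jq.
have jpos : 0 < j.+1%:R^-1 :> R by rewrite invr_gt0.
have [i [wi Hi]] := bad_term_far q0 jpos ww.1 (Hj q q0 jq).
by have [i' ii'] := iotaP i wi; exists i'; rewrite /F derive1n0 ii'; exact: Hi.
Qed.

(** Countable covering by intervals with rational endpoints; those on which [P] is not negligible
    are replaced by the empty set. *)
Lemma locally_negligible (A P : set R) :
  (forall x, A x -> exists a b, a < x < b /\ mu.-negligible [set y | a < y < b /\ P y]) ->
  mu.-negligible (A `&` P).
Proof.
move=> loc.
pose I (pq : rat * rat) := [set y : R | ratr pq.1 < y < ratr pq.2 /\ P y].
pose H (o : option (rat * rat)) : set R :=
  if o is Some pq then if `[< mu.-negligible (I pq) >] then I pq else set0 else set0.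
pose G (k : nat) := H (unpickle k).
have Gn k : mu.-negligible (G k).
  rewrite /G; case: (unpickle k) => [pq|]; last exact: negligible_set0.
  by rewrite /H; case: asboolP => // _; exact: negligible_set0.
apply: negligibleS (negligible_bigcup Gn) => x [/loc[a [b [/andP[ax xb] abn]]] Px].
have [p] := rat_in_itvoo ax; have [q] := rat_in_itvoo xb.
rewrite !in_itv/= => /andP[xq qb] /andP[ap px].
exists (pickle (p, q)); first exact: Logic.I.
have -> : G (pickle (p, q)) = H (Some (p, q)) by rewrite /G pickleK.
rewrite /H; case: asboolP => [_|[]]; first by rewrite /I /= px xq.
by apply: negligibleS abn => y [/andP[py yq] Py]; split => //; lra.
Qed.

End Reduction.

Theorem theorem2 (R : realType) (n : nat) (w theta : 'rV[R]_n)
    (U : set R) (f : R -> 'rV[R]_n) :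
  is_weight w ->
  nondegenerate_curve U f ->
  {ae @lebesgue_measure R, forall x, U x -> ~ Bad theta w (f x)}.
Proof.
move=> ww [_ _ [l ndU]].
have := @locally_negligible R (nondegenerate_at l f) (fun x => Bad theta w (f x))
  (fun x nd => Bad_locally_negligible theta ww nd).
move=> /(negligibleU ndU); apply: negligibleS => x /= H.
have [nd|nnd] := pselect (nondegenerate_at l f x); last first.
  by left => h; apply: H => /h.
by right; split => //; apply: contrapT => nB; apply: H.
Qed.
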